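(* There is an algorithm which, given a visualized matrix $A\in\mathbb{R}_{\max}^{n\times n}$ with $\lambda(A)=0$ having $m$ finite entries, and a critical elementary circuit $\mathcal{C}$ of length $\ell$ in $\mathcal{G}(A)$, computes in $O(\ell(m+n\log n))$ time all the rows and all the columns of $(A^{\otimes\ell})^{*}$ indexed by the nodes of $\mathcal{C}$; that is, for all nodes $i$ of $\mathcal{C}$ and all $j\in\{1,\dots,n\}$, the maximum weights of all $i$-$j$ paths, and of all $j$-$i$ paths, in $\mathcal{G}(A)$ whose lengths are multiples of $\ell$.
   Context: Max-plus algebra: $\mathbb{R}_{\max}=\mathbb{R}\cup\{\varepsilon\}$, $\varepsilon=-\infty$, $a\oplus b=\max(a,b)$, $a\otimes b=a+b$; matrix operations and powers are defined as usual with these operations. An entry is finite if it is $\ne\varepsilon$. For $A=(a_{ij})\in\mathbb{R}_{\max}^{n\times n}$, $\mathcal{G}(A)$ is the weighted digraph on $\{1,\dots,n\}$ with arcs $(i,j)$ whenever $a_{ij}\neq\varepsilon$, of weight $a_{ij}$. Paths are node sequences following arcs (nodes may repeat, length $0$ allowed); length is the number of arcs, weight the sum of the arc weights. A circuit is a closed path; it is elementary if no node is repeated apart from the coinciding start and end. The mean weight of a circuit is its weight divided by its length; $\lambda(A)$ is the maximum mean weight of circuits in $\mathcal{G}(A)$, and a circuit is critical if its mean weight equals $\lambda(A)$. $A$ is visualized if $a_{ij}\le\lambda(A)$ for all $i,j$. The Kleene star is $B^*=I_n\oplus B\oplus B^{\otimes2}\oplus\cdots$, where $I_n$ is the max-plus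 unit matrix. A maximum over an empty set is $\varepsilon$. Time is the number of elementary operations, arithmetic operations and comparisons on reals counting as unit cost. *)

(* Defs.v *)
From HB Require Import structures.
From mathcomp Require Import all_boot all_order all_algebra.
From mathcomp Require Import boolp classical_sets reals exp.

Set Implicit Arguments.
Unset Strict Implicit.
Unset Printing Implicit Defensive.

Import Order.TTheory GRing.Theory Num.Theory.

Local Open Scope classical_set_scope.
Local Open Scope ring_scope.

(** * The max-plus semiring *)

(* [None] stands for epsilon = -oo.  [option R] is wrapped so that it can carry
   the max-plus structure; with it, [A *m B] and [A ^+ k] on ['M[Rmax R]_n] are
   the max-plus product and power.  Beware that the semiring constants are
   [0 : Rmax R] = epsilon and [1 : Rmax R] = [Fin 0]. *)
Definition Rmax (R : realType) : Type := option R.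
HB.instance Definition _ (R : realType) := Choice.on (Rmax R).

Definition Fin {R : realType} (r : R) : Rmax R := Some r.
Definition Eps {R : realType} : Rmax R := None.

Section MaxPlus.
Context {R : realType}.
Implicit Types x y z : Rmax R.

Definition rmax_add x y : Rmax R :=
  match x, y with
  | Some a, Some b => Some (Num.max a b)
  | Some _, None => x
  | None, _ => y
  end.

Definition rmax_mul x y : Rmax R :=
  match x, y with
  | Some a, Some b => Some (a + b)
  | _, _ => None
  end.

Definition rmax_le x y : bool :=
  match x, y with
  | None, _ => true
  | Some _, None => false
  | Some a, Some b => a <= b
  end.

Fact rmax_addA : associative rmax_add.
Proof. by move=> [a|] [b|] [c|] //=; rewrite maxA. Qed.

Fact rmax_addC : commutative rmax_add.
Proof. by move=> [a|] [b|] //=; rewrite maxC. Qed.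

Fact rmax_add0 : left_id Eps rmax_add.
Proof. by []. Qed.

HB.instance Definition _ :=
  GRing.isNmodule.Build (Rmax R) rmax_addA rmax_addC rmax_add0.

Fact rmax_mulA : associative rmax_mul.
Proof. by move=> [a|] [b|] [c|] //=; rewrite addrA. Qed.

Fact rmax_mulC : commutative rmax_mul.
Proof. by move=> [a|] [b|] //=; rewrite addrC. Qed.

Fact rmax_mul1 : left_id (Fin 0) rmax_mul.
Proof. by move=> [a|] //=; rewrite add0r. Qed.

Fact rmax_mulDl : left_distributive rmax_mul rmax_add.
Proof. by move=> [a|] [b|] [c|] //=; rewrite addr_maxl. Qed.

Fact rmax_mul0 : left_zero Eps rmax_mul.
Proof. by []. Qed.

Fact rmax_oneNzero : Fin 0 != Eps :> Rmax R.
Proof. by []. Qed.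

HB.instance Definition _ :=
  GRing.Nmodule_isComNzSemiRing.Build (Rmax R)
    rmax_mulA rmax_mulC rmax_mul1 rmax_mulDl rmax_mul0 rmax_oneNzero.

(* [x] is the maximum of the set of reals [S], the maximum of the empty set
   being epsilon. *)
Definition is_max (S : set R) x : Prop :=
  match x with
  | Some r => S r /\ ubound S r
  | None => S = set0
  end.

(* The junk value epsilon is returned when [S] is nonempty without maximum. *)
Definition max_of (S : set R) : Rmax R := xget Eps [set x | is_max S x].

End MaxPlus.

(** * The weighted digraph of a matrix *)

Section Digraph.
Context {R : realType} {n : nat}.
Implicit Types (A B : 'M[Rmax R]_n) (i j : 'I_n) (p c : seq 'I_n).

Definition arc A : rel 'I_n := fun i j => A i j != Eps.

(* Only meaningful on arcs. *)
Definition arc_weight A i j : R := odflt 0 (A i j).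

Definition num_finite A : nat := #|[set ij : 'I_n * 'I_n | arc A ij.1 ij.2]|.

(* As in [path], a path is given by its first node [i] and the sequence [p] of
   the following ones, so that its length is [size p]. *)
Fixpoint path_weight A i p : R :=
  if p is j :: p' then arc_weight A i j + path_weight A j p' else 0.

(* As in [cycle], a circuit of length l > 0 is the sequence of its l nodes, the
   starting node not being repeated at the end. *)
Definition circuit A c : bool := (c != [::]) && cycle (arc A) c.

Definition elementary_circuit A c : bool := circuit A c && uniq c.

Definition circuit_weight A c : R :=
  if c is i :: p then path_weight A i (rcons p i) else 0.

Definition mean_weight A c : R := circuit_weight A c / (size c)%:R.

Definition lambda A : Rmax R :=
  max_of [set w | exists2 c, circuit A c & w = mean_weight A c].

Definition critical A c : Prop := circuit A c /\ Fin (mean_weight A c) = lambda A.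

Definition visualized A : Prop := forall i j, rmax_le (A i j) (lambda A).

(* The entrywise maximum of the entries of all the powers of [B]. *)
Definition kleene_star B : 'M[Rmax R]_n :=
  \matrix_(i, j) max_of [set w | exists k : nat, (B ^+ k) i j = Fin w].

Definition path_weights_mod A (l : nat) i j : set R :=
  [set w | exists p, [/\ path (arc A) i p, last i p = j, (l %| size p)%N
                       & w = path_weight A i p]].

End Digraph.

(** * A real random access machine with unit costs *)

(* The memory consists of arrays of natural numbers and arrays of reals, all of
   unbounded length.  Programs name arrays by constants and address their cells
   by computed indices; a scalar variable is a cell with a constant index. *)
Record memory (R : realType) := Memory {
  ints : nat -> nat -> nat;
  reals : nat -> nat -> R
}.

(* The only integer operations are addition and truncated subtraction, and a
   real cannot be converted to an integer: unit costs could otherwise be abused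
   by packing data into a single cell. *)
Inductive iexp : Type :=
  | INum of nat
  | IGet of nat & iexp
  | IAdd of iexp & iexp
  | ISub of iexp & iexp.

Inductive rexp : Type :=
  | RNum of nat
  | RGet of nat & iexp
  | RAdd of rexp & rexp
  | RSub of rexp & rexp
  | RMul of rexp & rexp
  | RDiv of rexp & rexp.

Inductive bexp : Type :=
  | BLeI of iexp & iexp
  | BLeR of rexp & rexp
  | BNot of bexp
  | BAnd of bexp & bexp.

Inductive cmd : Type :=
  | Skip
  | ISet of nat & iexp & iexp
  | RSet of nat & iexp & rexp
  | Seq of cmd & cmd
  | If of bexp & cmd & cmd
  | While of bexp & cmd.

Fixpoint icost (e : iexp) : nat :=
  match e with
  | INum _ => 1
  | IGet _ e1 => (icost e1).+1
  | IAdd e1 e2 | ISub e1 e2 => (icost e1 + icost e2).+1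
  end.

Fixpoint rcost (e : rexp) : nat :=
  match e with
  | RNum _ => 1
  | RGet _ e1 => (icost e1).+1
  | RAdd e1 e2 | RSub e1 e2 | RMul e1 e2 | RDiv e1 e2 =>
      (rcost e1 + rcost e2).+1
  end.

Fixpoint bcost (b : bexp) : nat :=
  match b with
  | BLeI e1 e2 => (icost e1 + icost e2).+1
  | BLeR e1 e2 => (rcost e1 + rcost e2).+1
  | BNot b1 => (bcost b1).+1
  | BAnd b1 b2 => (bcost b1 + bcost b2).+1
  end.

Section Semantics.
Context {R : realType}.
Implicit Types s : memory R.

Fixpoint ieval s (e : iexp) : nat :=
  match e with
  | INum k => k
  | IGet a e1 => ints s a (ieval s e1)
  | IAdd e1 e2 => (ieval s e1 + ieval s e2)%N
  | ISub e1 e2 => (ieval s e1 - ieval s e2)%N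
  end.

Fixpoint reval s (e : rexp) : R :=
  match e with
  | RNum k => k%:R
  | RGet a e1 => reals s a (ieval s e1)
  | RAdd e1 e2 => reval s e1 + reval s e2
  | RSub e1 e2 => reval s e1 - reval s e2
  | RMul e1 e2 => reval s e1 * reval s e2
  | RDiv e1 e2 => reval s e1 / reval s e2
  end.

Fixpoint beval s (b : bexp) : bool :=
  match b with
  | BLeI e1 e2 => (ieval s e1 <= ieval s e2)%N
  | BLeR e1 e2 => reval s e1 <= reval s e2
  | BNot b1 => ~~ beval s b1
  | BAnd b1 b2 => beval s b1 && beval s b2
  end.

Definition update T (f : nat -> nat -> T) (a k : nat) (v : T) : nat -> nat -> T :=
  fun a' k' => if (a' == a) && (k' == k) then v else f a' k'.

Definition iset s (a k v : nat) : memory R :=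
  Memory (update (ints s) a k v) (reals s).

Definition rset s (a k : nat) (v : R) : memory R :=
  Memory (ints s) (update (reals s) a k v).

(* [exec p s t s']: started in [s], the program [p] terminates in [s'] after
   [t] elementary operations. *)
Inductive exec : cmd -> memory R -> nat -> memory R -> Prop :=
  | ExecSkip s : exec Skip s 1 s
  | ExecISet a e1 e2 s :
      exec (ISet a e1 e2) s (icost e1 + icost e2).+1
        (iset s a (ieval s e1) (ieval s e2))
  | ExecRSet a e1 e2 s :
      exec (RSet a e1 e2) s (icost e1 + rcost e2).+1
        (rset s a (ieval s e1) (reval s e2))
  | ExecSeq p1 p2 s s1 s2 t1 t2 :
      exec p1 s t1 s1 -> exec p2 s1 t2 s2 -> exec (Seq p1 p2) s (t1 + t2) s2
  | ExecIf b p1 p2 s s' t :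
      exec (if beval s b then p1 else p2) s t s' ->
      exec (If b p1 p2) s (bcost b + t).+1 s'
  | ExecWhileStop b p s :
      ~~ beval s b -> exec (While b p) s (bcost b).+1 s
  | ExecWhileStep b p s s1 s2 t1 t2 :
      beval s b -> exec p s t1 s1 -> exec (While b p) s1 t2 s2 ->
      exec (While b p) s (bcost b + t1 + t2).+1 s2.

End Semantics.

(** * Input and output conventions *)

Section InputOutput.
Context {R : realType} {n : nat}.
Implicit Types (A : 'M[Rmax R]_n) (arcs : seq ('I_n * 'I_n)).

(* The matrix is given by the list of its finite entries, in any order. *)
Definition lists_arcs A arcs : Prop :=
  uniq arcs /\ forall i j, ((i, j) \in arcs) = arc A i j.

(* Nodes are numbered from 0.  All cells beyond the input contain 0. *)
Definition input A arcs (c : seq 'I_n) : memory R :=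
  Memory
    (fun a k =>
       match a with
       | 0 => nth 0 [:: n; size arcs; size c] k
       | 1 => nth 0 [seq val e.1 | e <- arcs] k
       | 2 => nth 0 [seq val e.2 | e <- arcs] k
       | 3 => nth 0 [seq val i | i <- c] k
       | _ => 0
       end%N)
    (fun a k =>
       if a == 0%N then nth 0 [seq arc_weight A e.1 e.2 | e <- arcs] k else 0).

Definition output_entry (s : memory R) (flag value k : nat) : Rmax R :=
  if ints s flag k == 0%N then Eps else Fin (reals s value k).

(* For the [k]-th node i of the circuit and a node j, the entries (i, j) and
   (j, i) of the result, at position k * n + j of the output arrays. *)
Definition row_output (s : memory R) (k : nat) (j : 'I_n) : Rmax R :=
  output_entry s 4 1 (k * n + j).

Definition col_output (s : memory R) (k : nat) (j : 'I_n) : Rmax R :=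
  output_entry s 5 2 (k * n + j).

End InputOutput.

(* Main.v *)
Require Import Defs.
From mathcomp Require Import all_boot all_order all_algebra.
From mathcomp Require Import boolp classical_sets reals exp.
From mathcomp Require Import zify ring lra.
(* [arc] is to be the relation of the digraph, not the part of a cycle *)
Import Defs.

Import Order.TTheory GRing.Theory Num.Theory.
Set Implicit Arguments.
Unset Strict Implicit.
Unset Printing Implicit Defensive.

(** Since lambda(A) = 0 and A is visualized, no arc has a positive weight, and
    every arc of the critical circuit c_0, ..., c_(l-1) has weight 0.

    Consider the n * l pairs (j, r) of a node j and a layer r < l, an arc from
    i to j leading from (i, r) to (j, r + 1 mod l).  The paths of the layered
    graph from (c_0, 0) to (j, r) are the paths of A from c_0 to j whose length
    is r modulo l.  The circuit leads from c_0 to c_k with k arcs and back with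
    l - k arcs, in both cases at weight 0.  So the weights of the paths from
    c_k to j of length 0 modulo l are the weights of the paths from c_0 to j of
    length k modulo l, that is, of the paths to (j, k) ([path_weights_reach]).
    A single search from (c_0, 0) therefore finds all the rows, and the number
    k * n + j given to the pair (j, k) is the place of the entry (c_k, j) in
    the output.  The columns are the rows of the transposed matrix.  There the
    circuit is traversed backwards, so that an arc has to lead to the layer
    r - 1, and the same numbering fits again.

    The search is Dijkstra's algorithm, for N = n * l nodes and l * m arcs
    ([search_spec]).  As N is at most n ^ 2, the time O(l m + N log N) is the
    one required, and it is reached with a Fibonacci heap: a forest ordered by
    keys, where an increased key is handled by cutting its node off, and a node
    that has lost two children is cut off as well.  The number of children of
    a node is then logarithmic ([deg_lt]).  A removed child is not deleted from
    the list of its parent: the entry becomes stale and is skipped when the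
    list is read, so that singly linked lists are enough.

    Running times are bounded by credits: a statement about a command starts
    with a number of time units, and its postcondition tells how many are left
    ([wp]).  Loop invariants store the credits that pay for the future in the
    potential of the heap ([potential]) and in a reserve for the nodes and arcs
    that are still to be treated ([search_credit]). *)

(** * Commands with time credits *)

(** From [s] and with [T] credits, [p] terminates, pays for its elementary
    operations, and leaves a state and a number of credits that satisfy [Q];
    credits may be thrown away. *)
Definition wp (R : realType) (p : cmd) (T : nat) (s : memory R)
    (Q : nat -> memory R -> Prop) : Prop :=
  exists t T' s', [/\ exec p s t s', t + T' <= T & Q T' s'].

Fixpoint straight (p : cmd) : bool :=
  match p with
  | Seq p1 p2 | If _ p1 p2 => straight p1 && straight p2
  | While _ _ => false
  | _ => true
  end.

(** A bound for the cost of a loop-free command.  Both branches of a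
    conditional are counted, which avoids maxima; the body of a loop is counted
    once, so that the value for a program exceeds the cost of one iteration of
    each of its loops. *)
Fixpoint ctime (p : cmd) : nat :=
  match p with
  | Skip => 1
  | ISet _ e1 e2 => (icost e1 + icost e2).+1
  | RSet _ e1 e2 => (icost e1 + rcost e2).+1
  | Seq p1 p2 => ctime p1 + ctime p2
  | If b p1 p2 => (bcost b + (ctime p1 + ctime p2)).+1
  | While b p1 => (bcost b + ctime p1).+1
  end.

Fixpoint iwrites (p : cmd) : seq nat :=
  match p with
  | ISet a _ _ => [:: a]
  | Seq p1 p2 | If _ p1 p2 => iwrites p1 ++ iwrites p2
  | While _ p1 => iwrites p1
  | _ => [::]
  end.

Fixpoint rwrites (p : cmd) : seq nat :=
  match p with
  | RSet a _ _ => [:: a]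
  | Seq p1 p2 | If _ p1 p2 => rwrites p1 ++ rwrites p2
  | While _ p1 => rwrites p1
  | _ => [::]
  end.

Section Logic.
Context {R : realType}.
Implicit Types (p : cmd) (s : memory R) (Q : nat -> memory R -> Prop) (T : nat).

(** Only meaningful for loop-free commands. *)
Fixpoint den p s : memory R :=
  match p with
  | Skip => s
  | ISet a e1 e2 => iset s a (ieval s e1) (ieval s e2)
  | RSet a e1 e2 => rset s a (ieval s e1) (reval s e2)
  | Seq p1 p2 => den p2 (den p1 s)
  | If b p1 p2 => if beval s b then den p1 s else den p2 s
  | While _ _ => s
  end.

Lemma exec_straight p s :
  straight p -> exists2 t, exec p s t (den p s) & t <= ctime p.
Proof.
elim: p s => //= [|a e1 e2|a e1 e2|p1 IH1 p2 IH2|b p1 IH1 p2 IH2] s.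
- by move=> _; exists 1 => //; exact: ExecSkip.
- by move=> _; exists (icost e1 + icost e2).+1 => //; exact: ExecISet.
- by move=> _; exists (icost e1 + rcost e2).+1 => //; exact: ExecRSet.
- case/andP=> /(IH1 s)[t1 h1 l1] /(IH2 (den p1 s))[t2 h2 l2].
  by exists (t1 + t2); [exact: ExecSeq h1 h2 | exact: leq_add].
case/andP=> /(IH1 s)[t1 h1 l1] /(IH2 s)[t2 h2 l2].
case E: (beval s b).
  by exists (bcost b + t1).+1; [apply: ExecIf; rewrite E | lia].
by exists (bcost b + t2).+1; [apply: ExecIf; rewrite E | lia].
Qed.

Lemma wp_straight p T s Q : straight p -> ctime p <= T ->
  Q (T - ctime p) (den p s) -> wp p T s Q.
Proof.
move=> /(exec_straight s)[t ht le_t] leT HQ.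
by exists t, (T - ctime p), (den p s); split=> //; lia.
Qed.

Lemma wp_mono p T s Q Q' : wp p T s Q ->
  (forall T' s', Q T' s' -> Q' T' s') -> wp p T s Q'.
Proof. by move=> [t [T' [s' [h le q]]]] QQ'; exists t, T', s'; split=> //; apply: QQ'. Qed.

Lemma wp_seq p1 p2 T s Q :
  wp p1 T s (fun T1 s1 => wp p2 T1 s1 Q) -> wp (Seq p1 p2) T s Q.
Proof.
move=> [t1 [T1 [s1 [h1 le1 [t2 [T2 [s2 [h2 le2 q]]]]]]]].
by exists (t1 + t2), T2, s2; split=> //; [exact: ExecSeq h1 h2 | lia].
Qed.

(** The invariant carries the credits that are left.  Every iteration spends
    at least one of them, hence the loop terminates. *)
Lemma wp_while b p T s (I : nat -> memory R -> Prop) Q : I T s ->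
  (forall T s, I T s -> beval s b ->
     (bcost b).+1 <= T /\ wp p (T - (bcost b).+1) s I) ->
  (forall T s, I T s -> ~~ beval s b ->
     (bcost b).+1 <= T /\ Q (T - (bcost b).+1) s) ->
  wp (While b p) T s Q.
Proof.
move=> I0 step stop; elim/ltn_ind: T s I0 => T IH s Is.
case: (boolP (beval s b)) => [bs|nbs].
  have [leT [t [T1 [s1 [h1 le1 I1]]]]] := step _ _ Is bs.
  have /(IH T1) : T1 < T by lia.
  move=> /(_ s1 I1)[t2 [T2 [s2 [h2 le2 q]]]].
  exists (bcost b + t + t2).+1, T2, s2; split=> //; last lia.
  exact: ExecWhileStep bs h1 h2.
have [leT q] := stop _ _ Is nbs.
exists (bcost b).+1, (T - (bcost b).+1), s; split=> //; last lia.
exact: ExecWhileStop.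
Qed.

Lemma wp_straight_le c p T s Q : straight p -> ctime p <= c -> c <= T ->
  (forall T', T <= T' + c -> Q T' (den p s)) -> wp p T s Q.
Proof.
by move=> sp pc cT HQ; apply: wp_straight => //; [lia | apply: HQ; lia].
Qed.

(** [c] bounds the cost of the test and the body together; giving up the exact
    amount spares every invariant the expressions for it. *)
Lemma wp_while_straight c b p T s (I : nat -> memory R -> Prop) Q :
  straight p -> (bcost b).+1 + ctime p <= c -> I T s ->
  (forall T s, I T s -> beval s b ->
     c <= T /\ forall T', T <= T' + c -> I T' (den p s)) ->
  (forall T s, I T s -> ~~ beval s b ->
     c <= T /\ forall T', T <= T' + c -> Q T' s) ->
  wp (While b p) T s Q.
Proof.
move=> sp pc I0 step stop; apply: (wp_while I0) => {I0}T {}s Is bs.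
  have [cT next] := step _ _ Is bs; split; first lia.
  by apply: wp_straight => //; [lia | apply: next; lia].
have [cT q] := stop _ _ Is bs; split; first lia.
by apply: q; lia.
Qed.

(** Whether an array is modified is decided by the text of the command, so
    everything stored in other arrays survives without being mentioned in
    loop invariants. *)
Definition same_outside p s s' : Prop :=
  (forall a, a \notin iwrites p -> forall k, ints s' a k = ints s a k) /\
  (forall a, a \notin rwrites p -> forall k, reals s' a k = reals s a k).

Lemma exec_frame p s t s' : exec p s t s' -> same_outside p s s'.
Proof.
rewrite /same_outside; elim=> {p s t s'} //=.
- by move=> a e1 e2 s; split=> // a'; rewrite inE /update /= => /negPf->.
- by move=> a e1 e2 s; split=> // a'; rewrite inE /update /= => /negPf->.
- move=> p1 p2 s s1 s2 t1 t2 _ [i1 r1] _ [i2 r2].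
  by split=> a; rewrite mem_cat negb_or => /andP[n1 n2] k; rewrite ?i2 ?i1 ?r2 ?r1.
- move=> b p1 p2 s s' t _ [i1 r1].
  by split=> a; rewrite mem_cat negb_or => /andP[n1 n2] k;
    [apply: i1; case: ifP | apply: r1; case: ifP].
- move=> b p s s1 s2 t1 t2 _ _ [i1 r1] _ [i2 r2].
  by split=> a h k; rewrite ?i2 ?i1 ?r2 ?r1.
Qed.

Lemma wp_frame p T s Q : wp p T s Q ->
  wp p T s (fun T' s' => Q T' s' /\ same_outside p s s').
Proof.
by move=> [t [T' [s' [h le q]]]]; exists t, T', s'; split=> //; split=> //;
  exact: exec_frame h.
Qed.

Lemma den_seq p q s : den (Seq p q) s = den q (den p s).
Proof. by []. Qed.

Lemma den_if e p q s :
  den (If e p q) s = if beval s e then den p s else den q s.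
Proof. by []. Qed.

Lemma den_frame p s : straight p -> same_outside p s (den p s).
Proof. by move=> /(exec_straight s)[t ex _]; apply: exec_frame ex. Qed.

Lemma frame_ints p s s' a :
  same_outside p s s' -> a \notin iwrites p -> ints s' a = ints s a.
Proof. by move=> [fi _] na; apply/funext => k; apply: fi. Qed.

Lemma frame_reals p s s' a :
  same_outside p s s' -> a \notin rwrites p -> reals s' a = reals s a.
Proof. by move=> [_ fr] na; apply/funext => k; apply: fr. Qed.

End Logic.

(** * The heap and its operations *)

Definition upd T (f : nat -> T) (k : nat) (v : T) : nat -> T :=
  fun k' => if k' == k then v else f k'.

Lemma upd_same T (f : nat -> T) k v : upd f k v k = v.
Proof. by rewrite /upd eqxx. Qed.

Lemma upd_other T (f : nat -> T) k v x : x != k -> upd f k v x = f x.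
Proof. by rewrite /upd => /negPf->. Qed.

(** All the counts that occur in the invariant and in the potential are sums
    over nodes or degrees, and an operation changes them at one place at a
    time. *)
Lemma sum_change N (F F' : nat -> nat) y : y < N ->
  (forall x, x < N -> x != y -> F' x = F x) ->
  (\sum_(x < N) F' x) + F y = (\sum_(x < N) F x) + F' y.
Proof.
move=> yN eqF; rewrite (bigD1 (Ordinal yN)) //= [in RHS](bigD1 (Ordinal yN)) //=.
rewrite (eq_bigr (fun i : 'I_N => F i)); first lia.
by move=> i; rewrite -val_eqE /= => ne; rewrite eqF.
Qed.

Lemma sum_ge N (F : nat -> nat) y : y < N -> F y <= \sum_(x < N) F x.
Proof. by move=> yN; rewrite (bigD1 (Ordinal yN)) //= leq_addr. Qed.

Lemma sum_push (st : nat -> nat) k x z :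
  \sum_(i < k.+1) (upd st k x i == z) = \sum_(i < k) (st i == z) + (x == z).
Proof.
rewrite big_ord_recr /= upd_same; congr addn.
by apply: eq_bigr => i _; rewrite upd_other // neq_ltn ltn_ord.
Qed.

(** The linked list with head [h] runs through [cells].  Pointers to [c] are
    stored as [c.+1], and [0] ends the list, as cells are initially zero. *)
Fixpoint chain (next : nat -> nat) (h : nat) (cells : seq nat) : Prop :=
  if cells is c :: cells' then h = c.+1 /\ chain next (next c) cells'
  else h = 0.

Lemma chain_ext nx nx' h l :
  (forall c, c \in l -> nx' c = nx c) -> chain nx h l -> chain nx' h l.
Proof.
elim: l h => //= c l IH h eqn [-> ch]; split=> //.
rewrite eqn ?inE ?eqxx //; apply: IH ch => c' c'l.
by rewrite eqn // inE c'l orbT.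
Qed.

(** The integer arrays of the heap, seen as functions.  The roots of the forest
    are on the stack [stk] of height [top] or in the table [tab], where a root
    of degree [d] is found at [d].  In [tab], [par], [hd] and [nxt], a reference
    to [x] is stored as [x.+1], and [0] means that there is none.  The list of
    the children of a node starts at [hd] and has the entries [kid]; it may
    contain nodes that have another parent by now, whereas [deg] counts the true
    children only.  [mark] is the number of children lost by a node since it has
    got its parent. *)
Record heap := Heap {
  top : nat; stk : nat -> nat;
  tab : nat -> nat; tabmax : nat;
  par : nat -> nat; mark : nat -> nat; deg : nat -> nat;
  hd : nat -> nat; kid : nat -> nat; nxt : nat -> nat; fresh : nat
}.

Definition kids_of (h : heap) (N x : nat) : nat :=
  \sum_(y < N) (par h y == x.+1).

Definition kids_below (h : heap) (N x k : nat) : nat :=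
  \sum_(y < N) ((par h y == x.+1) && (deg h y + mark h y < k)).

(** The number of places where [x] is stored as a root. *)
Definition at_root (h : heap) (x : nat) : nat :=
  \sum_(i < top h) (stk h i == x) + (tab h (deg h x) == x.+1).

Section Heap.
Context {R : realType}.
Variable N : nat.
Implicit Types (h : heap) (act : nat -> bool) (key : nat -> R)
  (f : nat -> nat) (K : nat -> seq nat) (b : nat).

(** [act] are the nodes in the heap.  The node [b], if it is less than [N], has
    just been extracted and may still have children.  The ghost [f] decreases
    from parents to children, which excludes cycles, and [K x] are the cells of
    the list of [x].  [inv_rank] is what bounds the degrees: a node is linked to
    a node of its own degree, and [deg + mark] does not change while its parent
    remains, so at most [k] children have a value less than [k].  [inv_root]
    says at once that the roots in the heap are stored, that nothing else is,
    and that nothing is stored twice. *)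
Record heap_inv b act key h f K : Prop := Inv {
  inv_act : forall x, act x -> x < N;
  inv_par : forall y x, y < N -> par h y = x.+1 ->
    [/\ x < N, act y, act x || (x == b), (key y <= key x)%R & f y < f x];
  inv_mark : forall y, y < N -> par h y = 0 -> mark h y = 0;
  inv_deg : forall x, x < N -> deg h x = kids_of h N x;
  inv_rank : forall x k, x < N -> kids_below h N x k <= k;
  inv_root : forall x, x < N ->
    (act x && (par h x == 0) : nat) = at_root h x;
  inv_stk : forall i, i < top h -> stk h i < N;
  inv_tab : forall d x, tab h d = x.+1 ->
    [/\ x < N, deg h x = d & d <= tabmax h];
  inv_chain : forall x, x < N ->
    chain (nxt h) (hd h x) (K x) /\ all (ltn^~ (fresh h)) (K x);
  inv_kid : forall y x, y < N -> par h y = x.+1 -> y \in map (kid h) (K x);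
  inv_out : forall y, N <= y -> par h y = 0
}.

(** The operations act on the root on top of the stack.  [settle] moves it into
    the table; [link] makes [y] a child of [x], one of them being the top of the
    stack and the other one in the table, and puts [x] on the stack. *)
Definition settle h (x : nat) (m : nat) : heap :=
  Heap (top h).-1 (stk h) (upd (tab h) (deg h x) x.+1) m
       (par h) (mark h) (deg h) (hd h) (kid h) (nxt h) (fresh h).

Definition link h x y : heap :=
  Heap (top h).-1.+1 (upd (stk h) (top h).-1 x)
       (upd (tab h) (deg h y) 0) (tabmax h)
       (upd (par h) y x.+1) (mark h) (upd (deg h) x (deg h x).+1)
       (upd (hd h) x (fresh h).+1) (upd (kid h) (fresh h) y)
       (upd (nxt h) (fresh h) (hd h x)) (fresh h).+1.

(** Moves the root at [d] of the table to the stack; the new stack [st] is a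
    parameter, as the order on the stack will depend on the keys. *)
Definition unsettle h d st : heap :=
  Heap (top h).+1 st (upd (tab h) d 0) (tabmax h)
       (par h) (mark h) (deg h) (hd h) (kid h) (nxt h) (fresh h).

Definition pop h : heap :=
  Heap (top h).-1 (stk h) (tab h) (tabmax h)
       (par h) (mark h) (deg h) (hd h) (kid h) (nxt h) (fresh h).

Definition push h x : heap :=
  Heap (top h).+1 (upd (stk h) (top h) x) (tab h) (tabmax h)
       (par h) (mark h) (deg h) (hd h) (kid h) (nxt h) (fresh h).

Definition cut h x y : heap :=
  Heap (top h).+1 (upd (stk h) (top h) y) (tab h) (tabmax h)
       (upd (par h) y 0)
       (upd (if par h x == 0 then mark h
             else upd (mark h) x (mark h x).+1) y 0)
       (upd (deg h) x (deg h x).-1)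
       (hd h) (kid h) (nxt h) (fresh h).

Definition drop_kid h x c : heap :=
  Heap (top h) (stk h) (tab h) (tabmax h) (par h) (mark h) (deg h)
       (upd (hd h) x (nxt h c)) (kid h) (nxt h) (fresh h).

Lemma top_root b act key h f K x : heap_inv b act key h f K ->
  0 < top h -> x = stk h (top h).-1 ->
  [/\ x < N, act x, par h x = 0, tab h (deg h x) != x.+1 &
      forall z, z < N -> \sum_(i < (top h).-1) (stk h i == z) + (x == z)
        = \sum_(i < top h) (stk h i == z)].
Proof.
move=> I t0 ex; have xN : x < N by rewrite ex; apply: (inv_stk I); lia.
have sumz z : \sum_(i < (top h).-1) (stk h i == z) + (x == z)
        = \sum_(i < top h) (stk h i == z).
  by rewrite -[top h in RHS](prednK t0) big_ord_recr /= ex.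
have := inv_root I xN; rewrite /at_root -sumz eqxx.
by case: (act x) => //=; case: (par h x) => [|p] //=;
   case: eqP => //=; try lia; move=> e _; split=> //.
Qed.

Lemma inv_settle b act key h f K x m : heap_inv b act key h f K ->
  0 < top h -> x = stk h (top h).-1 -> tab h (deg h x) = 0 ->
  tabmax h <= m -> deg h x <= m -> heap_inv b act key (settle h x m) f K.
Proof.
move=> I t0 ex tx arg_m dm; have [xN ax px _ sumz] := top_root I t0 ex.
case: (I) => i1 i2 i3 i4 i5 i6 i7 i8 i9 i10; split=> //=.
- move=> z zN; rewrite i6 // /at_root /= -sumz // /upd.
  have [ez|/eqP nez] := eqVneq z x; first by rewrite ez !eqxx tx /=; lia.
  rewrite -addnA; congr addn.
  case: (deg h z =P deg h x) => [->|_]; rewrite ?tx //; lia.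
- by move=> i hi; apply: i7; lia.
- move=> d z; rewrite /upd; case: eqP => [-> [<-] //|_ /i8[? ? ?]].
  by split=> //; lia.
Qed.

(** The new child has [deg + mark] equal to the former degree of [x], which is
    the number of the other children; so the bound on the children of small
    rank survives for every [k].  The ghost [f] may be raised at [x] because a
    root has no parent. *)
Lemma inv_link b act key h f K x y : heap_inv b act key h f K -> 0 < top h ->
  (x = stk h (top h).-1 /\ tab h (deg h x) = y.+1 \/
   y = stk h (top h).-1 /\ tab h (deg h y) = x.+1) ->
  (key y <= key x)%R ->
  heap_inv b act key (link h x y) (upd f x (f x + f y).+1)
    (upd K x (fresh h :: K x)).
Proof.
move=> I t0 exy kyx; have [] // : 
  [/\ [/\ x < N, act x, par h x = 0 & deg h x = deg h y],
      [/\ y < N, act y & par h y = 0], x != y,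
      tab h (deg h y) = x.+1 \/ tab h (deg h y) = y.+1 &
      forall z, z < N -> \sum_(i < (top h).-1) (stk h i == z) +
        ((x == z) + (y == z)) = \sum_(i < top h) (stk h i == z) +
          (tab h (deg h y) == z.+1)].
  have aux u v : u = stk h (top h).-1 -> tab h (deg h u) = v.+1 ->
    [/\ [/\ u < N, act u & par h u = 0], deg h u = deg h v,
      [/\ v < N, act v & par h v = 0], u != v &
      forall z, z < N -> \sum_(i < (top h).-1) (stk h i == z) +
        ((u == z) + (v == z)) = \sum_(i < top h) (stk h i == z) +
          (tab h (deg h u) == z.+1)].
    move=> eu ev; have [uN au pu ntu sumz] := top_root I t0 eu.
    have [vN /esym dv _] := inv_tab I ev.
    have := inv_root I vN; rewrite /at_root -dv ev eqxx.
    rewrite ev in ntu.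
    case av : (act v) => //=; last lia.
    case: (par h v =P 0) => pv /=; last lia.
    move=> _; split=> //; first by apply: contraNneq ntu => ->.
    by move=> z zN; rewrite -sumz // eqSS addnA.
  case: exy => -[e1 e2]; have [[? ? ?] dd [? ? ?] ? sumz] := aux _ _ e1 e2.
    by rewrite -dd; split=> //; right.
  split=> //; first by rewrite eq_sym.
    by left.
  by move=> z zN; rewrite -sumz //; lia.
move=> [xN ax px dxy] [yN ay py] nxy ety sumz.
case: (I) => i1 i2 i3 i4 i5 i6 i7 i8 i9 i10 i11.
have cz z : z < N ->
    kids_of (link h x y) N z = kids_of h N z + (z == x).
  move=> zN; rewrite /kids_of.
  have := @sum_change N (fun u => (par h u == z.+1) : nat)
     (fun u => (par (link h x y) u == z.+1) : nat) y yN.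
  rewrite /= upd_same py eqSS [x == z]eq_sym addn0; apply.
  by move=> u uN nu; rewrite upd_other.
split=> //=.
- move=> u z uN; rewrite {1}/upd; case: (u =P y) => [-> [<-]|/eqP nu puz].
    by rewrite upd_same upd_other 1?eq_sym //; split=> //; [rewrite ax|lia].
  have [zN au az kuz fuz] := i2 _ _ uN puz; split=> //.
  rewrite [upd _ _ _ u]upd_other; last by apply: contra_eq_neq puz => ->; rewrite px.
  by rewrite /upd; case: eqP => [ez|//]; subst z; lia.
- move=> z zN; rewrite /upd; case: eqP => // /eqP nz; exact: i3.
- move=> z zN; rewrite cz // /upd; case: eqP => [->|_]; rewrite ?i4 //; lia.
- move=> z k zN.
  have := @sum_change N (fun u => (par h u == z.+1) && (deg h u + mark h u < k) : nat)
     (fun u => (par (link h x y) u == z.+1) &&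
        (deg (link h x y) u + mark h u < k) : nat) y yN.
  move=> /= E; have {E} : kids_below (link h x y) N z k =
     kids_below h N z k + ((z == x) && (deg h x < k)).
    move: E; rewrite py [upd _ y _ y]upd_same [upd _ x _ y]upd_other 1?eq_sym //.
    rewrite (i3 y) // !addn0 -dxy eqSS [x == z]eq_sym; apply.
    move=> u uN nu; rewrite [upd _ y _ u]upd_other //.
    have [->|nux] := eqVneq u x; first by rewrite px.
    by rewrite upd_other.
  case: (z =P x) => [ez|_] /=; last by rewrite addn0 => ->; exact: i5.
  case: (ltnP (deg h x)) => [lk _|_]; last by rewrite addn0 => ->; exact: i5.
  apply: (@leq_trans (kids_of (link h x y) N z)).
    by apply: leq_sum => u _; move: (_ == z.+1) (_ < k) => [] [].
  by rewrite cz // -i4 // ez eqxx; lia.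
- move=> z zN; have := i6 z zN; rewrite /at_root /=.
  rewrite sum_push.
  have {sumz} := sumz z zN; set S := bigop _ _ _; set S' := bigop _ _ _.
  have [->|nzx] := eqVneq z x.
    have /negPf tx : tab h (deg h x).+1 != x.+1.
      by apply/eqP => /i8[]; lia.
    rewrite upd_same [upd _ y _ x]upd_other // upd_other ?tx; last by lia.
    by rewrite -dxy ax px (negPf (_ : y != x)) 1?eq_sym //=; lia.
  rewrite [upd _ x _ z]upd_other //.
  have [->|nzy] := eqVneq z y.
    rewrite !upd_same ay py /=; lia.
  rewrite [upd _ y _ z]upd_other //.
  rewrite /upd; case: (deg h z =P deg h y) => [->|nd]; last first.
    rewrite [tab h (deg h y) == _](introF eqP); first by lia.
    by move=> /i8[].
  have [nx ny] : (x == z) = false /\ (y == z) = false.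
    by rewrite ![_ == z]eq_sym; split; apply: negPf.
  by case: ety => ->; rewrite !eqSS ?nx ?ny; lia.
- move=> i hi; rewrite /upd; case: eqP => // /eqP ni; apply: i7; lia.
- move=> d z; rewrite {1}/upd; case: eqP => // /eqP nd /[dup] etz /i8[zN dz dm].
  by rewrite upd_other //; apply: contraTneq nd => ez; rewrite -dz ez dxy eqxx.
- move=> z zN; have [ch al] := i9 z zN.
  have chz : chain (upd (nxt h) (fresh h) (hd h x)) (hd h z) (K z).
    apply: chain_ext ch => c /(allP al) /= lc.
    by rewrite upd_other // neq_ltn lc.
  have alz : all (ltn^~ (fresh h).+1) (K z).
    by apply: sub_all al => c /= ?; lia.
  have [ez|nz] := eqVneq z x; last by rewrite !upd_other.
  by subst z; rewrite !upd_same /= upd_same leqnn.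
- move=> u z uN; rewrite {1}/upd; case: eqP => [-> [<-]|_ puz].
    by rewrite upd_same /= upd_same inE eqxx.
  have [zN _ _ _ _] := i2 _ _ uN puz.
  have eqK : map (upd (kid h) (fresh h) y) (K z) = map (kid h) (K z).
    have [_ /allP al] := i9 z zN; apply/eq_in_map => c /al /= lc.
    by rewrite upd_other // neq_ltn lc.
  have := i10 u z uN puz; rewrite -eqK /upd; case: (z =P x) => [->|//] /=.
  by rewrite inE => ->; rewrite orbT.
- move=> z Nz; rewrite upd_other; first exact: i11.
  by apply: contraTneq Nz => ->; rewrite -ltnNge.
Qed.

Lemma inv_unsettle b act key h f K x d st : heap_inv b act key h f K ->
  tab h d = x.+1 -> (forall i, i < (top h).+1 -> st i < N) ->
  (forall z, z < N -> \sum_(i < (top h).+1) (st i == z) =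
                      \sum_(i < top h) (stk h i == z) + (x == z)) ->
  heap_inv b act key (unsettle h d st) f K.
Proof.
move=> I tx stN sumz; case: (I) => i1 i2 i3 i4 i5 i6 i7 i8 i9 i10 i11.
have [xN dx _] := i8 _ _ tx.
split=> //=.
- move=> z zN; rewrite i6 // /at_root /= sumz // -addnA; congr addn.
  have [->|nzx] := eqVneq z x; first by rewrite dx upd_same tx eqxx.
  rewrite /upd; case: (deg h z =P d) => [->|_] //; rewrite tx eqSS.
  by rewrite eq_sym (negPf nzx).
- by move=> e z; rewrite /upd; case: eqP => // _; exact: i8.
Qed.

Lemma inv_pop act key h f K u : heap_inv N act key h f K ->
  0 < top h -> u = stk h (top h).-1 -> (forall d, tab h d = 0) ->
  heap_inv u (fun x => act x && (x != u)) key (pop h) f K.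
Proof.
move=> I t0 eu t_0; have [uN au pu _ sumz] := top_root I t0 eu.
case: (I) => i1 i2 i3 i4 i5 i6 i7 i8 i9 i10 i11.
split=> //=.
- by move=> x /andP[/i1].
- move=> y x yN pyx; have [xN -> ax kyx fyx] := i2 y x yN pyx; split=> //.
    by apply: contra_eq_neq pyx => ->; rewrite pu.
  by case: (x =P u) ax => [|_]; rewrite ?orbT // (ltn_eqF xN) !orbF andbT.
- move=> z zN; have := i6 z zN; rewrite /at_root /= -sumz // !t_0 !addn0.
  have [->|nzu] := eqVneq z u; first by rewrite au pu eqxx /=; lia.
  by rewrite andbT addn0.
- by move=> i hi; apply: i7; lia.
Qed.

(** If [x] is not a root, it loses a child and gains a mark, so its rank among
    its own siblings is unchanged. *)
Lemma inv_cut b act key h f K x y : heap_inv b act key h f K ->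
  y < N -> par h y = x.+1 -> (forall d, tab h d = 0) ->
  heap_inv b act key (cut h x y) f K.
Proof.
move=> I yN pyx t_0; case: (I) => i1 i2 i3 i4 i5 i6 i7 i8 i9 i10 i11.
have [xN ay ax kyx fyx] := i2 _ _ yN pyx.
have nyx : y != x by apply: contraTneq fyx => ->; rewrite ltnn.
have cz z : z < N ->
    kids_of (cut h x y) N z + (z == x) = kids_of h N z.
  move=> zN; rewrite /kids_of.
  have := @sum_change N (fun u => (par h u == z.+1) : nat)
     (fun u => (par (cut h x y) u == z.+1) : nat) y yN.
  rewrite /= upd_same pyx eqSS [x == z]eq_sym [0 == _]/= addn0; apply.
  by move=> u uN nu; rewrite upd_other.
have dx0 : 0 < deg h x by rewrite i4 // -cz // eqxx addn1.
split=> //=.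
- by move=> z w zN; rewrite /upd; case: eqP => // _; exact: i2.
- move=> z zN; have [->|nzy] := eqVneq z y.
    by rewrite !upd_same.
  rewrite ![upd _ y _ z]upd_other // => pz.
  case: eqP => px; first exact: i3.
  rewrite upd_other; first exact: i3.
  by apply: contra_not_neq px => <-.
- move=> z zN; have := cz z zN; have := i4 z zN.
  by rewrite /upd; case: (z =P x) => [->|_]; lia.
- move=> z k zN; apply: leq_trans (i5 z k zN).
  apply: leq_sum => u _ /=; have [->|nuy] := eqVneq (u : nat) y.
    by rewrite upd_same.
  rewrite [upd (par h) _ _ _]upd_other //.
  have [->|nux] := eqVneq (u : nat) x.
    rewrite [upd _ y _ x]upd_other 1?eq_sym //.
    by case: (par h x =P 0) => [->//|_]; rewrite !upd_same addnS -addSn prednK.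
  rewrite [upd (deg h) _ _ _]upd_other //.
  rewrite [upd _ y _ _]upd_other //.
  by case: (par h x =P 0) => _; rewrite ?upd_other.
- move=> z zN; have := i6 z zN; rewrite /at_root /= !t_0 sum_push !addn0.
  have [->|nzy] := eqVneq z y; first by rewrite ay upd_same pyx /=; lia.
  by rewrite upd_other // addn0.
- by move=> i hi; rewrite /upd; case: eqP => // /eqP ni; apply: i7; lia.
- by move=> d z; rewrite t_0.
- by move=> z w zN; rewrite /upd; case: eqP => // _; exact: i10.
- by move=> z Nz; rewrite /upd; case: eqP => // _; exact: i11.
Qed.

(** A cell may be dropped only if its node is no child of [x] any more, since the
    list has to contain all the children. *)
Lemma inv_drop b act key h f K x c l : heap_inv b act key h f K ->
  x < N -> K x = c :: l -> par h (kid h c) != x.+1 ->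
  heap_inv b act key (drop_kid h x c) f (upd K x l).
Proof.
move=> I xN Kx pc; case: (I) => i1 i2 i3 i4 i5 i6 i7 i8 i9 i10 i11.
split=> //=.
- move=> z zN; have := i9 z zN; rewrite /upd; case: eqP => // ->.
  by rewrite Kx /= => -[[_ ch] /andP[_ al]].
- move=> y z yN pyz; have := i10 y z yN pyz; rewrite /upd; case: eqP => // ez.
  rewrite ez in pyz *; rewrite Kx inE => /orP[/eqP ey|//].
  by rewrite -ey pyz eqxx in pc.
Qed.

Lemma inv_close b act key h f K : heap_inv b act key h f K ->
  b < N -> hd h b = 0 -> heap_inv N act key h f K.
Proof.
move=> I bN hb; case: (I) => i1 i2 i3 i4 i5 i6 i7 i8 i9 i10 i11.
split=> // y x yN pyx; have [xN ay ax kyx fyx] := i2 _ _ yN pyx.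
split=> //; case/orP: ax => [->//|/eqP ex].
have := i10 _ _ yN pyx; have [] := i9 _ xN; rewrite ex hb.
by case: (K b) => // c l [].
Qed.

Lemma inv_key b act key key' h f K v : heap_inv b act key h f K ->
  par h v = 0 -> (forall x, x != v -> key' x = key x) ->
  (forall y, y < N -> par h y = v.+1 -> (key y <= key' v)%R) ->
  heap_inv b act key' h f K.
Proof.
move=> I pv eqk lek; case: (I) => i1 i2 i3 i4 i5 i6 i7 i8 i9 i10 i11.
split=> // y x yN pyx; have [xN ay ax kyx fyx] := i2 _ _ yN pyx.
split=> //; rewrite (eqk y); last by apply: contra_eq_neq pyx => ->; rewrite pv.
have [ex|nx] := eqVneq x v; last by rewrite eqk.
by rewrite ex; apply: lek; rewrite // -ex.
Qed.

Lemma inv_push act key h f K v : heap_inv N act key h f K ->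
  v < N -> ~~ act v -> heap_inv N (fun x => act x || (x == v)) key (push h v) f K.
Proof.
move=> I vN nav; case: (I) => i1 i2 i3 i4 i5 i6 i7 i8 i9 i10 i11.
have pv : par h v = 0.
  by case E: (par h v) => [//|p]; have [_ av] := i2 _ _ vN E; rewrite av in nav.
split=> //=.
- by move=> x /orP[/i1//|/eqP->].
- move=> y x yN /i2[] // xN -> ax kyx fyx; split=> //.
  by rewrite orbAC ax.
- move=> z zN; have := i6 z zN; rewrite /at_root /= sum_push.
  have [->|nz] := eqVneq z v; first by rewrite (negPf nav) pv /=; lia.
  by rewrite orbF addn0.
- by move=> i hi; rewrite /upd; case: eqP => // /eqP ni; apply: i7; lia.
Qed.

(** Going up from [x] the keys increase; the node with the largest [f] among
    those whose key is at least that of [x] must be a root. *)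
Lemma root_above act key h f K x : heap_inv N act key h f K -> act x ->
  exists r, [/\ r < N, act r, par h r = 0 & (key x <= key r)%R].
Proof.
move=> I ax; have xN := inv_act I ax.
pose P := [pred z : 'I_N | act z && (key x <= key z)%R].
have Px : P (Ordinal xN) by rewrite /= ax lexx.
case: (arg_maxnP (fun z : 'I_N => f z) Px) => r /andP[ar kr] maxr.
exists r; split=> //; case E: (par h r) => [//|p].
have [pN _ ap krp frp] := inv_par I (ltn_ord r) E.
have := maxr (Ordinal pN); rewrite /= (le_trans kr krp) andbT.
move: ap; rewrite (ltn_eqF pN) orbF => -> /(_ isT); lia.
Qed.

Definition deg_bound : nat := 3 * (trunc_log 2 N).+1.

(** Let [cnt k] be the number of nodes of degree at least [k].  At most [k.+1]
    children of a node have [deg + mark < k.+1], so a node of degree at least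
    [k + 3] has two children with [deg + mark > k], hence of degree at least
    [k].  Children of distinct nodes are distinct, so [cnt (k + 3)] is at most
    half of [cnt k]. *)
Lemma deg_lt b act key h f K x : heap_inv b act key h f K ->
  (forall y, y < N -> mark h y <= 1) -> x < N -> deg h x < deg_bound.
Proof.
move=> I m1 xN.
pose cnt k := \sum_(y < N) (k <= deg h y).
have step k : 2 * cnt (k + 3) <= cnt k.
  have le2 (z : 'I_N) : 2 * (k + 3 <= deg h z) <=
      \sum_(y < N) ((par h y == z.+1) && (k <= deg h y)).
    case: (leqP (k + 3) (deg h z)) => //= dz; have := inv_rank I (k.+1) (ltn_ord z).
    have : kids_of h N z <= kids_below h N z k.+1 +
        \sum_(y < N) ((par h y == z.+1) && (k <= deg h y)).
      rewrite -big_split; apply: leq_sum => y _ /=.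
      have := m1 y (ltn_ord y); case: (_ == _) => //=.
      by case: (ltnP (deg h y + _)); case: (leqP k) => //; lia.
    rewrite -(inv_deg I) // muln1; move: (kids_below _ _ _ _) (bigop _ _ _) => A B; lia.
  rewrite /cnt big_distrr /=.
  apply: (@leq_trans (\sum_(z < N) \sum_(y < N)
            ((par h y == z.+1) && (k <= deg h y)))).
    exact: leq_sum.
  rewrite exchange_big; apply: leq_sum => y _ /=.
  case: (k <= deg h y); last by under eq_bigr do rewrite andbF; rewrite big1.
  under eq_bigr do rewrite andbT.
  case E: (par h y) => [|p]; first by rewrite big1.
  have [pN _ _ _ _] := inv_par I (ltn_ord y) E.
  rewrite (bigD1 (Ordinal pN)) //= eqxx big1 // => z.
  by rewrite -val_eqE /= eqSS eq_sym => /negPf->.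
have pow j : 2 ^ j * cnt (3 * j) <= N.
  elim: j => [|j IH].
    rewrite mul1n -[leqRHS]card_ord -sum1_card; apply: leq_sum => y _.
    exact: leq_b1.
  apply: leq_trans IH; rewrite expnS [2 * _]mulnC -mulnA leq_mul2l.
  by rewrite mulnS addnC step orbT.
rewrite ltnNge; apply/negP => dx.
have := pow (trunc_log 2 N).+1.
have : 0 < cnt (3 * (trunc_log 2 N).+1).
  apply: leq_trans (sum_ge (fun y => 3 * (trunc_log 2 N).+1 <= deg h y : nat) xN).
  by rewrite /= dx.
have := @trunc_log_ltn 2 N isT.
move: (_ ^ _) (cnt _) => A B; nia.
Qed.

End Heap.

(** * The search program *)

(* The arrays: those of the heap (see [heap_of]); REACHED, set for the nodes
   reached so far, with their keys in KEY; the lists of the arcs leaving each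
   node of the given graph (ARCS, ARC_NEXT) with their heads (ARC_HEAD); and for
   each layered node the number of the first node of its layer (LAYER) and of
   the next one (NEXT_LAYER).  A variable is the cell 0 of an array of its own:
   vX, vY and vP hold nodes of the forest, vD a degree, vC a cell, vU the node
   extracted last, vE an arc plus one, vV its head, vSIZE the number of layered
   nodes and vI a loop counter. *)

Notation REACHED := 6 (only parsing).
Notation STACK := 7 (only parsing).
Notation TABLE := 8 (only parsing).
Notation PARENT := 9 (only parsing).
Notation MARK := 10 (only parsing).
Notation DEGREE := 11 (only parsing).
Notation KIDS := 12 (only parsing).
Notation CELL_KID := 13 (only parsing).
Notation CELL_NEXT := 14 (only parsing).
Notation ARCS := 15 (only parsing).
Notation ARC_NEXT := 16 (only parsing).
Notation ARC_HEAD := 17 (only parsing).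
Notation LAYER := 18 (only parsing).
Notation NEXT_LAYER := 19 (only parsing).
Notation TOP := 20 (only parsing).
Notation FRESH := 21 (only parsing).
Notation MAX_DEGREE := 22 (only parsing).
Notation vX := 23 (only parsing).
Notation vY := 24 (only parsing).
Notation vP := 25 (only parsing).
Notation vD := 26 (only parsing).
Notation vU := 27 (only parsing).
Notation vE := 28 (only parsing).
Notation vV := 29 (only parsing).
Notation vC := 30 (only parsing).
Notation vSIZE := 31 (only parsing).
Notation vI := 32 (only parsing).
Notation WEIGHT := 0 (only parsing).
Notation KEY := 3 (only parsing).
Notation CANDIDATE := 4 (only parsing).

Notation "p ;; q" := (Seq p q) (at level 90, q at level 90, right associativity).
Notation var a := (IGet a (INum 0)).
Notation setv a e := (ISet a (INum 0) e).
Notation incr a := (setv a (IAdd (INum 1) (var a))).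
Notation pred_e e := (ISub e (INum 1)).
Notation iszero e := (BLeI e (INum 0)).

Definition replace_code : cmd :=
  ISet STACK (var TOP) (var vX) ;; incr TOP ;;
  ISet TABLE (IGet DEGREE (var vY)) (INum 0) ;;
  ISet PARENT (var vY) (IAdd (INum 1) (var vX)).

Definition adopt_code : cmd :=
  ISet CELL_KID (var FRESH) (var vY) ;; ISet CELL_NEXT (var FRESH) (IGet KIDS (var vX)) ;;
  incr FRESH ;; ISet KIDS (var vX) (var FRESH) ;;
  ISet DEGREE (var vX) (IAdd (INum 1) (IGet DEGREE (var vX))).

Definition settle_code : cmd :=
  ISet TABLE (IGet DEGREE (var vX)) (IAdd (INum 1) (var vX)) ;;
  If (BLeI (IGet DEGREE (var vX)) (var MAX_DEGREE)) Skip (setv MAX_DEGREE (IGet DEGREE (var vX))).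

Definition select_code : cmd :=
  setv vY (pred_e (IGet TABLE (IGet DEGREE (var vX)))) ;;
  If (BLeR (RGet KEY (var vY)) (RGet KEY (var vX))) Skip
     (setv vP (var vX) ;; setv vX (var vY) ;; setv vY (var vP)).

Definition pop_code : cmd :=
  setv TOP (pred_e (var TOP)) ;; setv vX (IGet STACK (var TOP)).

(** The root on top of the stack either finds its place in the table free, or is
    linked with the root found there; the winner returns to the stack.  Thus a
    single loop reduces the forest to at most one root for each degree. *)
Definition consolidate_body : cmd :=
  pop_code ;;
  If (iszero (IGet TABLE (IGet DEGREE (var vX))))
     settle_code
     (select_code ;; replace_code ;; adopt_code).

Definition consolidate : cmd :=
  While (BNot (iszero (var TOP))) consolidate_body.

(** The root vX is pushed, but below the top of the stack if its key is smaller: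
    the best of the roots collected so far stays on top. *)
Definition collect_push : cmd :=
  If (BAnd (BLeI (INum 1) (var TOP))
           (BLeR (RGet KEY (var vX)) (RGet KEY (IGet STACK (pred_e (var TOP))))))
     (ISet STACK (var TOP) (IGet STACK (pred_e (var TOP))) ;;
      ISet STACK (pred_e (var TOP)) (var vX))
     (ISet STACK (var TOP) (var vX)) ;;
  incr TOP.

Definition collect_body : cmd :=
  If (iszero (IGet TABLE (var vD))) Skip
     (setv vX (pred_e (IGet TABLE (var vD))) ;;
      ISet TABLE (var vD) (INum 0) ;;
      collect_push) ;;
  incr vD.

Definition collect : cmd := While (BLeI (var vD) (var MAX_DEGREE)) collect_body.

Definition cut_code : cmd :=
  If (iszero (IGet PARENT (var vP))) Skip
     (ISet MARK (var vP) (IAdd (INum 1) (IGet MARK (var vP)))) ;;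
  ISet MARK (var vY) (INum 0) ;;
  ISet PARENT (var vY) (INum 0) ;;
  ISet DEGREE (var vP) (pred_e (IGet DEGREE (var vP))) ;;
  ISet STACK (var TOP) (var vY) ;; incr TOP.

(** An entry of the list of vU is stale if its node has another parent by now, or
    none; then it is only dropped. *)
Definition release_body : cmd :=
  setv vP (var vU) ;;
  setv vC (pred_e (IGet KIDS (var vU))) ;;
  setv vY (IGet CELL_KID (var vC)) ;;
  ISet KIDS (var vU) (IGet CELL_NEXT (var vC)) ;;
  If (BAnd (BLeI (IGet PARENT (var vY)) (IAdd (INum 1) (var vU)))
           (BLeI (IAdd (INum 1) (var vU)) (IGet PARENT (var vY))))
     cut_code Skip.

Definition release : cmd :=
  While (BNot (iszero (IGet KIDS (var vU)))) release_body.

(** Cuts vY off.  If its parent has now lost two children, it is the next one to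
    be cut off; otherwise vY has become a root, which ends the loop. *)
Definition cascade_body : cmd :=
  setv vP (pred_e (IGet PARENT (var vY))) ;;
  cut_code ;;
  If (BLeI (INum 2) (IGet MARK (var vP))) (setv vY (var vP)) Skip.

Definition cascade : cmd :=
  While (BNot (iszero (IGet PARENT (var vY)))) cascade_body.

(** If the arc offers a better key to its head vV, then vV has to be cut off.
    Otherwise vY is set to the extracted node, which has no parent, so that the
    cascade stops immediately.  The same happens for a head that has not been
    reached yet, whatever the outcome of the test of its key. *)
Definition arc_code : cmd :=
  setv vV (IAdd (IGet ARC_HEAD (pred_e (var vE))) (IGet NEXT_LAYER (var vU))) ;;
  RSet CANDIDATE (INum 0) (RAdd (RGet KEY (var vU)) (RGet WEIGHT (pred_e (var vE)))) ;;
  setv vE (IGet ARC_NEXT (pred_e (var vE))) ;;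
  If (BLeR (RGet CANDIDATE (INum 0)) (RGet KEY (var vV)))
     (setv vY (var vU)) (setv vY (var vV)).

(** A better key is stored after the cascade, when vV has no parent any more; so the
    forest is ordered by keys at any time. *)
Definition improve_code : cmd :=
  If (iszero (IGet REACHED (var vV)))
     (ISet REACHED (var vV) (INum 1) ;; RSet KEY (var vV) (RGet CANDIDATE (INum 0)) ;;
      ISet STACK (var TOP) (var vV) ;; incr TOP)
     (If (BLeR (RGet CANDIDATE (INum 0)) (RGet KEY (var vV))) Skip
         (RSet KEY (var vV) (RGet CANDIDATE (INum 0)))).

Definition relax : cmd :=
  While (BNot (iszero (var vE))) (arc_code ;; cascade ;; improve_code).

Definition extract_code : cmd :=
  setv vU (IGet STACK (pred_e (var TOP))) ;; setv TOP (pred_e (var TOP)).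

Definition first_arc_code : cmd :=
  setv vE (IGet ARCS (ISub (var vU) (IGet LAYER (var vU)))).

Definition search_body : cmd :=
  consolidate ;; setv vD (INum 0) ;; collect ;; extract_code ;; release ;;
  first_arc_code ;; relax.

Definition search : cmd := While (BNot (iszero (var TOP))) search_body.

(** The price of one loop iteration or of one short command.  It is kept
    abstract, so that the numbers in the cost estimates stay small. *)
Fact unit_cost_subproof : {u : nat | ctime search <= u}.
Proof. by exists (ctime search). Qed.

Definition unit_cost : nat := sval unit_cost_subproof.

Section HeapCode.
Context {R : realType}.
Variable N : nat.
Implicit Types (s : memory R) (act : nat -> bool) (key : nat -> R)
  (f : nat -> nat) (K : nat -> seq nat) (b : nat).

Definition heap_of s : heap :=
  Heap (ints s TOP 0) (ints s STACK) (ints s TABLE) (ints s MAX_DEGREE 0)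
       (ints s PARENT) (ints s MARK) (ints s DEGREE)
       (ints s KIDS) (ints s CELL_KID) (ints s CELL_NEXT) (ints s FRESH 0).

Lemma heap_pop s : heap_of (den pop_code s) = pop (heap_of s).
Proof. rewrite /pop -!subn1. by []. Qed.

Definition add_kid h x y : heap :=
  Heap (top h) (stk h) (tab h) (tabmax h) (par h) (mark h)
       (upd (deg h) x (deg h x).+1)
       (upd (hd h) x (fresh h).+1) (upd (kid h) (fresh h) y)
       (upd (nxt h) (fresh h) (hd h x)) (fresh h).+1.

Lemma heap_adopt s :
  heap_of (den adopt_code s) = add_kid (heap_of s) (ints s vX 0) (ints s vY 0).
Proof. by []. Qed.

Lemma heap_link s h : heap_of s = pop h ->
  heap_of (den (replace_code ;; adopt_code) s) = link h (ints s vX 0) (ints s vY 0).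
Proof.
rewrite [den _ _]/(den adopt_code (den replace_code s)) heap_adopt.
case: h => t st tb mx p mk d kh kd kn c [e1 e2 e3 e4 e5 e6 e7 e8 e9 e10 e11].
rewrite /link -e1 -e2 -e3 -e4 -e5 -e6 -e7 -e8 -e9 -e10 -e11. by [].
Qed.

Lemma heap_settle s h : heap_of s = pop h ->
  heap_of (den settle_code s) =
  settle h (ints s vX 0) (maxn (tabmax h) (deg h (ints s vX 0))).
Proof.
case: h => t st tb mx p mk d kh kd kn c [e1 e2 e3 e4 e5 e6 e7 e8 e9 e10 e11].
rewrite /settle -e1 -e2 -e3 -e4 -e5 -e6 -e7 -e8 -e9 -e10 -e11 /=.
by case: leqP.
Qed.

Local Notation B := (deg_bound N).

Definition tabs h : nat := \sum_(d < B) (tab h d != 0).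
Definition marks h : nat := \sum_(x < N) mark h x.
Definition cells K : nat := \sum_(x < N) size (K x).

(** A root on the stack costs 3 units: 1 to be moved into the table and 2 that
    it carries along.  A root in the table pays 1 for being linked and 1 for its
    new entry in a list, which pays for the entry being read later.  The 2 marks
    of a node that is cut off by a cascade pay 8 units: the step itself, the new
    root on the stack and the mark of its parent. *)
Definition potential h K : nat :=
  unit_cost * (3 * top h + 2 * tabs h + 4 * marks h + cells K).

Lemma tabs_upd h d v : d < B ->
  \sum_(e < B) (upd (tab h) d v e != 0) + (tab h d != 0) = tabs h + (v != 0).
Proof.
move=> dB; have := @sum_change B (fun e => tab h e != 0 : nat)
  (fun e => upd (tab h) d v e != 0 : nat) d dB.
by rewrite /= upd_same; apply=> x _ ?; rewrite upd_other.
Qed.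

Lemma cells_upd K x l : x < N -> cells (upd K x l) + size (K x) = cells K + size l.
Proof.
move=> xN; have := @sum_change N (fun e => size (K e))
  (fun e => size (upd K x l e)) x xN.
by rewrite /= upd_same; apply=> y _ ?; rewrite upd_other.
Qed.

Lemma potential_settle h K x m : 0 < top h -> deg h x < B ->
  tab h (deg h x) = 0 ->
  potential (settle h x m) K + unit_cost = potential h K.
Proof.
move=> t0 dB t_0; rewrite /potential /tabs /marks /=.
have := tabs_upd h x.+1 dB; rewrite t_0 addn0 => ->.
rewrite -{2}[unit_cost]muln1 -mulnDr; congr muln; rewrite /tabs; case: (top h) t0 => // t _.
rewrite /=; move: (bigop _ _ _) (bigop _ _ _) => A C; lia.
Qed.

Lemma potential_link h K x y : 0 < top h -> x < N -> deg h y < B ->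
  tab h (deg h y) != 0 ->
  potential (link h x y) (upd K x (fresh h :: K x)) + unit_cost = potential h K.
Proof.
move=> t0 xN dB t_0; rewrite /potential /marks /=.
have := tabs_upd h 0 dB; rewrite t_0 addn0 /tabs /=.
have := cells_upd K (fresh h :: K x) xN; rewrite /= prednK //.
rewrite -{2}[unit_cost]muln1 -mulnDr.
move: (bigop _ _ _) (bigop _ _ _) (bigop _ _ _) (cells _) (cells _).
move=> a b c d e e1 e2; congr muln; lia.
Qed.

Lemma potential_unsettle h K d st : d < B -> tab h d != 0 ->
  potential (unsettle h d st) K = potential h K + unit_cost.
Proof.
move=> dB t_0; rewrite /potential /marks /=.
have := tabs_upd h 0 dB; rewrite t_0 addn0 /tabs /=.
rewrite -{3}[unit_cost]muln1 -mulnDr.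
move: (bigop _ _ _) (bigop _ _ _) (bigop _ _ _) (cells _).
move=> a b c e e1; congr muln; lia.
Qed.

Lemma potential_pop h K : 0 < top h ->
  potential (pop h) K + 3 * unit_cost = potential h K.
Proof.
move=> t0; rewrite /potential /marks /tabs /=.
rewrite -{2}[unit_cost]muln1 mulnCA -mulnDr; congr muln.
move: (bigop _ _ _) (bigop _ _ _) (cells _) => a b c; lia.
Qed.

Lemma potential_push h K x : potential (push h x) K = potential h K + 3 * unit_cost.
Proof.
rewrite /potential /marks /tabs /=.
rewrite -{3}[unit_cost]muln1 mulnCA -mulnDr; congr muln.
move: (bigop _ _ _) (bigop _ _ _) (cells _) => a b c; lia.
Qed.

(** The marks of [y] pay for the cut; the mark of [x] is given only if [x] is not
    a root. *)
Lemma potential_cut h K x y : x < N -> y < N -> x != y ->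
  potential (cut h x y) K + 4 * unit_cost * mark h y =
  potential h K + 3 * unit_cost + 4 * unit_cost * (par h x != 0).
Proof.
move=> xN yN nxy.
have : marks (cut h x y) + mark h y = marks h + (par h x != 0).
  pose mk := if par h x == 0 then mark h else upd (mark h) x (mark h x).+1.
  have E1 : marks (cut h x y) + mk y = \sum_(z < N) mk z + 0.
    rewrite /marks /=; have := @sum_change N mk (upd mk y 0) y yN.
    by rewrite upd_same; apply=> z _ ?; rewrite upd_other.
  have E2 : \sum_(z < N) mk z + mark h x = marks h + mk x.
    apply: sum_change => // z _ nz; rewrite /mk.
    by case: ifP => // _; rewrite upd_other.
  have ey : mk y = mark h y.
    by rewrite /mk; case: ifP => // _; rewrite upd_other // eq_sym.
  have ex : mk x = mark h x + (par h x != 0).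
    by rewrite /mk; case: eqP => [|_] /=; rewrite ?upd_same; lia.
  lia.
rewrite /potential [top _]/=; have -> : tabs (cut h x y) = tabs h by [].
move: (marks _) (marks _) (tabs h) (cells K) (nat_of_bool _) (mark _ _).
move=> a b c d e g E.
have := congr1 (muln (4 * unit_cost)) E; move: unit_cost => u; lia.
Qed.

Lemma potential_drop h K x c l : x < N -> K x = c :: l ->
  potential (drop_kid h x c) (upd K x l) + unit_cost = potential h K.
Proof.
move=> xN Kx; rewrite /potential /marks /tabs /=.
have := cells_upd K l xN; rewrite Kx /=.
rewrite -{2}[unit_cost]muln1 -mulnDr.
move: (bigop _ _ _) (bigop _ _ _) (cells _) (cells _).
move=> a b d e e1; congr muln; lia.
Qed.

(** Between the operations no node has two marks. *)
Record heap_ok b act key h f K : Prop := HeapOk {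
  ok_inv : heap_inv N b act key h f K;
  ok_mark : forall y, y < N -> mark h y <= 1;
  ok_max : tabmax h < B
}.

Lemma consolidate_cost : (bcost (BNot (iszero (var TOP)))).+1 + ctime consolidate_body <= unit_cost.
Proof. by apply: leq_trans (svalP unit_cost_subproof); vm_compute. Qed.

Lemma select_spec s s' x y : s' = den select_code s ->
  x = ints s vX 0 -> y = (ints s TABLE (ints s DEGREE x)).-1 ->
  [/\ heap_of s' = heap_of s, reals s' = reals s,
      (reals s KEY (ints s' vY 0) <= reals s KEY (ints s' vX 0))%R &
      ints s' vX 0 = x /\ ints s' vY 0 = y \/
      ints s' vX 0 = y /\ ints s' vY 0 = x].
Proof.
move=> -> ex ey; rewrite /select_code den_seq.
set s1 := den (setv _ _) s.
have xs1 : ints s1 vX 0 = x by rewrite ex.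
have ys1 : ints s1 vY 0 = y by rewrite ey ex -subn1.
have -> : heap_of s = heap_of s1 by [].
have -> : reals s = reals s1 by [].
move: s1 xs1 ys1 => s1 xs1 ys1 /=.
rewrite ys1 xs1; case: leP => [le|/ltW gt].
  by rewrite ?xs1 ?ys1; split=> //; left.
by rewrite /update /= ?xs1 ?ys1; split=> //; right.
Qed.

Lemma consolidate_spec act s f K T T0 :
  heap_ok N act (reals s KEY) (heap_of s) f K ->
  potential (heap_of s) K + unit_cost + T0 <= T ->
  wp consolidate T s (fun T' s' => exists f' K',
    [/\ heap_ok N act (reals s' KEY) (heap_of s') f' K',
        top (heap_of s') = 0 &
        potential (heap_of s') K' + T0 <= T']).
Proof.
move=> ok0 leT.
apply: (wp_while_straight (I := fun T s => exists f K,
   heap_ok N act (reals s KEY) (heap_of s) f K /\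
   potential (heap_of s) K + unit_cost + T0 <= T) _ consolidate_cost) => //.
- by exists f, K.
- move=> {}T {leT ok0 f K}s [f [K [[I m1 mx] leT]]].
  rewrite [beval _ _]/= leqn0 -lt0n -[ints s TOP 0]/(top (heap_of s)) => t0.
  split=> [|T' leT']; first by lia.
  rewrite /consolidate_body den_seq.
  set s1 := den pop_code s.
  have hs1 : heap_of s1 = pop (heap_of s) by apply: heap_pop.
  have ks1 : reals s1 KEY = reals s KEY by [].
  have xs1 : ints s1 vX 0 = stk (heap_of s) (top (heap_of s)).-1 by rewrite -subn1.
  rewrite -ks1 in I.
  move: (heap_of s) (s1) => h {s1}s1 in I m1 mx leT t0 hs1 xs1 {ks1} *.
  have tE : ints s1 TABLE = tab h by have /(congr1 tab) := hs1.
  have dE : ints s1 DEGREE = deg h by have /(congr1 deg) := hs1.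
  have [xN ax px tx _] := top_root I t0 xs1.
  have xB := deg_lt I m1 xN.
  rewrite den_if [beval _ _]/= tE dE leqn0; case: eqP => [t_0|/eqP t_1].
    set s2 := (X in exists f K, heap_ok _ _ _ (heap_of X) _ _ /\ _).
    have -> : heap_of s2 = settle h (ints s1 vX 0) (maxn (tabmax h) (deg h (ints s1 vX 0))).
      exact: heap_settle.
    have -> : reals s2 = reals s1 by rewrite /s2 /=; case: ifP.
    exists f, K; split.
      by split=> //=; [apply: inv_settle; rewrite ?leq_maxl ?leq_maxr | lia].
    have := potential_settle K (maxn (tabmax h) (deg h (ints s1 vX 0))) t0 xB t_0.
    by lia.
  set y := (tab h (deg h (ints s1 vX 0))).-1.
  have ty : tab h (deg h (ints s1 vX 0)) = y.+1 by rewrite prednK // lt0n.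
  have [yN dy _] := inv_tab I ty.
  rewrite den_seq; set s2 := den select_code s1.
  have := @select_spec s1 s2 _ y erefl erefl; rewrite tE dE => /(_ erefl).
  move: s2 => s2 [hs2 rs2 kyx exy].
  rewrite hs1 in hs2; rewrite (heap_link hs2).
  have -> : reals (den (replace_code ;; adopt_code) s2) = reals s2 by [].
  rewrite rs2; move: (ints s2 vX 0) (ints s2 vY 0) => x' y' in kyx exy *.
  exists (upd f x' (f x' + f y').+1), (upd K x' (fresh h :: K x')).
  have [x'N dy'B ty'] : [/\ x' < N, deg h y' < B & tab h (deg h y') != 0].
    by case: exy => -[-> ->]; rewrite ?dy ty; split.
  split; last by have := potential_link K t0 x'N dy'B ty'; lia.
  split=> //; apply: inv_link => //.
  case: exy => -[-> ->]; [left | right; rewrite -ty]; rewrite ?dy; split=> //.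
- move=> {}T {leT ok0 f K}s [f [K [ok leT]]] /=; rewrite negbK leqn0 => /eqP t0.
  split=> [|T' leT']; first by lia.
  by exists f, K; split=> //; lia.
Qed.

Lemma collect_cost : (bcost (BLeI (var vD) (var MAX_DEGREE))).+1 + ctime collect_body <= unit_cost.
Proof. by apply: leq_trans (svalP unit_cost_subproof); vm_compute. Qed.

Definition top_max key h : Prop :=
  forall i, i < top h -> (key (stk h i) <= key (stk h (top h).-1))%R.

Lemma collect_push_frame s : reals (den collect_push s) = reals s /\
  ints (den collect_push s) vD = ints s vD.
Proof. by rewrite /collect_push den_seq den_if; case: ifP. Qed.

Lemma collect_push_spec s x (h := heap_of s) : x = ints s vX 0 ->
  top_max (reals s KEY) h ->
  exists st, [/\ heap_of (den collect_push s) =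
      Heap (top h).+1 st (tab h) (tabmax h) (par h) (mark h) (deg h)
           (hd h) (kid h) (nxt h) (fresh h),
    forall z, \sum_(i < (top h).+1) (st i == z) =
              \sum_(i < top h) (stk h i == z) + (x == z),
    forall P : nat -> Prop, P x -> (forall i, i < top h -> P (stk h i)) ->
      forall i, i < (top h).+1 -> P (st i) &
    top_max (reals s KEY) (heap_of (den collect_push s))].
Proof.
move=> ex mx.
set swp := (0 < top h) && (reals s KEY x <= reals s KEY (stk h (top h - 1)))%R.
exists (if swp then upd (upd (stk h) (top h) (stk h (top h - 1))) (top h - 1) x
        else upd (stk h) (top h) x).
have E : heap_of (den collect_push s) =
  Heap (top h).+1 (if swp then upd (upd (stk h) (top h) (stk h (top h - 1))) (top h - 1) x
        else upd (stk h) (top h) x) (tab h) (tabmax h) (par h) (mark h) (deg h)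
           (hd h) (kid h) (nxt h) (fresh h).
  rewrite /collect_push den_seq den_if [beval _ _]/= -ex.
  by rewrite -[X in if X then _ else _]/swp ex; case: swp.
rewrite {}E; clearbody h; split=> //.
- move=> z; case: ifP => [/andP[t0 _]|_]; last exact: sum_push.
  have [t et] : exists t, top h = t.+1 by case: (top h) t0 => // t; exists t.
  rewrite et subn1 /= big_ord_recr /= [in RHS]big_ord_recr /=.
  rewrite [upd _ t x t.+1]upd_other ?upd_same; last by lia.
  rewrite [in RHS]addnAC -[X in _ = X + _]sum_push; congr addn.
  apply: eq_bigr => i _; rewrite /upd; case: ((i : nat) =P t) => // _.
  by rewrite (ltn_eqF (ltn_ord i)).
- move=> P Px Ps i hi; case: ifP => [/andP[t0 _]|_]; rewrite /upd.
    case: eqP => // ni; case: eqP => [_|?]; apply: Ps; lia.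
  case: eqP => // ni; apply: Ps; lia.
- move=> i /=; case: ifP => [/andP[t0 le]|nle] hi.
    have [t et] : exists t, top h = t.+1 by case: (top h) t0 => // t; exists t.
    move: le hi (mx); rewrite /top_max et subn1 /= => le hi {}mx.
    rewrite [upd _ t x t.+1]upd_other ?upd_same; last by lia.
    rewrite /upd; case: eqP => // ni; case: eqP => // ni'; apply: mx; lia.
  rewrite upd_same /upd; case: eqP => // ni; have {}hi : i < top h by lia.
  apply: (le_trans (mx i hi)); move: nle; rewrite /swp subn1 (leq_ltn_trans _ hi) //=.
  by move/negbT; rewrite -ltNge => /ltW.
Qed.

(** All degrees are less than [B].  Each of them takes one unit for the loop and
    one for the return from the table to the stack. *)
Lemma collect_spec act s f K T T0 :
  heap_ok N act (reals s KEY) (heap_of s) f K ->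
  top (heap_of s) = 0 -> ints s vD 0 = 0 ->
  potential (heap_of s) K + 2 * unit_cost * B + unit_cost + T0 <= T ->
  wp collect T s (fun T' s' => 
    [/\ heap_ok N act (reals s' KEY) (heap_of s') f K,
        forall d, tab (heap_of s') d = 0,
        top_max (reals s' KEY) (heap_of s') &
        potential (heap_of s') K + T0 <= T']).
Proof.
move=> ok0 t0 d0 leT.
apply: (wp_while_straight (I := fun T s => 
   [/\ heap_ok N act (reals s KEY) (heap_of s) f K,
     forall d, d < ints s vD 0 -> tab (heap_of s) d = 0,
     top_max (reals s KEY) (heap_of s),
     ints s vD 0 <= B &
     potential (heap_of s) K + 2 * unit_cost * (B - ints s vD 0) + unit_cost + T0 <= T])
   _ collect_cost) => //.
- rewrite d0; split=> //.
  by move=> i; rewrite t0.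
- move=> {}T {leT ok0 t0 d0}s [[I m1 mx] t_0 tm dB leT].
  rewrite [beval _ _]/= => dm.
  split=> [|T' leT']; first by lia.
  have ltdB : ints s vD 0 < B by apply: leq_ltn_trans mx.
  set d := ints s vD 0 in t_0 dB leT dm ltdB *.
  have e2 : 2 * unit_cost * (B - d) = 2 * unit_cost * (B - d.+1) + 2 * unit_cost.
    by rewrite -mulnSr; congr muln; lia.
  have step s' : heap_of (den (incr vD) s') = heap_of s' by [].
  rewrite /collect_body den_seq den_if [beval _ _]/= leqn0.
  rewrite -[ints s TABLE _]/(tab (heap_of s) d).
  case: eqP => [td|/eqP td].
    rewrite [den Skip s]/=.
    have -> : ints (den (incr vD) s) vD 0 = d.+1 by [].
    have -> : reals (den (incr vD) s) KEY = reals s KEY by [].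
    rewrite step; split=> //; last by lia.
    by move=> e; rewrite ltnS leq_eqVlt => /predU1P[->|/t_0].
  rewrite !den_seq; set s1 := den _ (den _ s).
  set x := (tab (heap_of s) d).-1.
  have tx : tab (heap_of s) d = x.+1 by rewrite prednK // lt0n.
  have hs1 : heap_of s1 = Heap (top (heap_of s)) (stk (heap_of s))
    (upd (tab (heap_of s)) d 0) (tabmax (heap_of s)) (par (heap_of s))
    (mark (heap_of s)) (deg (heap_of s)) (hd (heap_of s)) (kid (heap_of s))
    (nxt (heap_of s)) (fresh (heap_of s)) by [].
  have xs1 : ints s1 vX 0 = x by rewrite /x -subn1.
  have ds1 : ints s1 vD 0 = d by [].
  have rs1 : reals s1 KEY = reals s KEY by [].
  have [] := collect_push_spec (esym xs1).
    by rewrite rs1 hs1; exact: tm.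
  rewrite -[den _ (den _ s1)]/(den collect_push s1).
  move=> st; rewrite hs1 rs1 => -[E sumz Ps tm'].
  set s2 := den collect_push s1 in E tm' *.
  have -> : heap_of (den (incr vD) s2) = heap_of s2 by [].
  have [rs2 ds2] := collect_push_frame s1; rewrite -/s2 in rs2 ds2.
  have -> : reals (den (incr vD) s2) KEY = reals s KEY by rewrite -rs1 -rs2.
  have -> : ints (den (incr vD) s2) vD 0 = d.+1 by rewrite -ds1 -ds2.
  have {}E : heap_of s2 = unsettle (heap_of s) d st by rewrite E.
  rewrite E in tm' *.
  have [xN dx _] := inv_tab I tx.
  split=> //.
  + split=> //; apply: (inv_unsettle I tx) => [i|z zN]; last exact: sumz.
    by apply: (Ps (fun z => z < N)) => // j /=; exact: (inv_stk I).
  + move=> e; rewrite ltnS leq_eqVlt => /predU1P[->|ed] /=; first by rewrite upd_same.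
    by rewrite upd_other; [exact: t_0 | rewrite neq_ltn ed].
  + have := potential_unsettle K st ltdB td; lia.
- move=> {}T {leT ok0 t0 d0}s [[I m1 mx] t_0 tm dB leT] /=; rewrite -ltnNge => gtd.
  split=> [|T' leT']; first by lia.
  split=> //; last by lia.
  move=> d; case: (ltnP d (ints s vD 0)) => [/t_0//|led].
  case E: (tab (heap_of s) d) => [//|x]; have [_ _] := inv_tab I E.
  by rewrite leqNgt (leq_trans gtd).
Qed.

(** Applied after [collect], when the table is empty: together with [root_above]
    it makes the top of the stack the best node of the whole heap. *)
Lemma root_in_stack b act key h f K r : heap_inv N b act key h f K ->
  (forall d, tab h d = 0) -> r < N -> act r -> par h r = 0 ->
  exists2 i, i < top h & stk h i = r.
Proof.
move=> I t_0 rN ar pr; have := inv_root I rN.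
rewrite ar pr /at_root t_0 addn0 /= => E.
have /existsP[i /eqP ei] : [exists i : 'I_(top h), stk h i == r].
  apply: contraPT E; rewrite negb_exists => /forallP ni.
  by rewrite big1 // => i _; rewrite (negPf (ni i)).
by exists i.
Qed.

Lemma reals_cut s : reals (den cut_code s) = reals s.
Proof. by rewrite /cut_code !den_seq den_if; case: ifP. Qed.

Lemma heap_cut s :
  heap_of (den cut_code s) = cut (heap_of s) (ints s vP 0) (ints s vY 0).
Proof. by rewrite /cut -!subn1 /cut_code den_seq den_if [beval _ _]/= leqn0; case: ifP. Qed.

Lemma vars_cut s a : a \notin iwrites cut_code -> ints (den cut_code s) a = ints s a.
Proof. exact: frame_ints (den_frame (p := cut_code) s isT). Qed.

Lemma release_cost :
  (bcost (BNot (iszero (IGet KIDS (var vU))))).+1 + ctime release_body <= unit_cost.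
Proof. by apply: leq_trans (svalP unit_cost_subproof); vm_compute. Qed.

(** The list entries pay for the iterations; only the true children, which
    become roots, have to be paid for. *)
Lemma release_spec act s u f K T T0 :
  heap_ok u act (reals s KEY) (heap_of s) f K ->
  (forall d, tab (heap_of s) d = 0) -> u < N -> ints s vU 0 = u ->
  par (heap_of s) u = 0 ->
  potential (heap_of s) K + 3 * unit_cost * deg (heap_of s) u + unit_cost + T0 <= T ->
  wp release T s (fun T' s' => exists K',
    [/\ heap_ok N act (reals s' KEY) (heap_of s') f K',
        forall d, tab (heap_of s') d = 0 &
        potential (heap_of s') K' + T0 <= T']).
Proof.
move=> ok0 t0 uN us pu leT.
apply: (wp_while_straight (I := fun T s => exists K,
   [/\ heap_ok u act (reals s KEY) (heap_of s) f K,
      forall d, tab (heap_of s) d = 0, ints s vU 0 = u,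
      par (heap_of s) u = 0 &
  potential (heap_of s) K + 3 * unit_cost * deg (heap_of s) u + unit_cost + T0 <= T])
  _ release_cost) => //.
- by exists K.
- move=> {}T {leT ok0 t0 us pu K}s [K [[I m1 mx] t0 us pu leT]].
  rewrite [beval _ _]/= leqn0 us -[ints s KIDS u]/(hd (heap_of s) u) => hu.
  split=> [|T' leT']; first by lia.
  have [c [l Ku]] : exists c l, K u = c :: l.
    have [] := inv_chain I uN; case: (K u) => [/= e|c l _ _]; last by exists c, l.
    by case/negP: hu; apply/eqP.
  have [] := inv_chain I uN; rewrite Ku => -[hc _] _.
  set y := kid (heap_of s) c.
  rewrite /release_body 4!den_seq.
  set s1 := den _ (den _ (den _ (den _ s))).
  have Ps1 : ints s1 vP 0 = u by rewrite -us.
  have cs1 : ints s1 vC 0 = c.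
    by rewrite -[c]subn0 -subSS -hc -us subn1 -subn1.
  have ys1 : ints s1 vY 0 = y by rewrite /y -cs1.
  have us1 : ints s1 vU 0 = u by rewrite -us.
  have rs1 : reals s1 = reals s by [].
  have hs1 : heap_of s1 = drop_kid (heap_of s) u c by rewrite -cs1 -us.
  move: s1 hs1 Ps1 cs1 ys1 us1 rs1 => s1 hs1 Ps1 cs1 ys1 us1 rs1.
  rewrite den_if [beval _ _]/= ys1 us1 -eqn_leq.
  have -> : ints s1 PARENT = par (heap_of s) by have /(congr1 par) := hs1.
  move: (heap_of s) => h in I m1 mx t0 us pu leT hu hc y ys1 hs1 *.
  case: eqP => [py|/eqP npy]; last first.
    exists (upd K u l); rewrite [den Skip s1]/= rs1 hs1; split=> //.
      by split=> //; apply: inv_drop.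
    by have := potential_drop h uN Ku; rewrite /=; lia.
  exists (upd K u l).
  have yN : y < N by rewrite ltnNge; apply/negP => /(inv_out I); rewrite py.
  have nuy : u != y by apply/eqP => e; rewrite -e pu in py.
  have d1 : 0 < deg h u.
    rewrite (inv_deg I) //; apply: leq_trans (sum_ge (fun z => par h z == u.+1 : nat) yN).
    by rewrite py eqxx.
  rewrite reals_cut rs1 heap_cut Ps1 ys1 hs1.
  have -> : cut (drop_kid h u c) u y = drop_kid (cut h u y) u c by [].
  split=> //.
  + split=> //.
      apply: inv_drop => //; last by rewrite /= upd_same.
      by apply: inv_cut; rewrite // -add1n.
    move=> z zN /=; rewrite /upd; case: eqP => // _.
    by rewrite pu /=; exact: m1.
  + by rewrite vars_cut.
  + by rewrite /= upd_other.
  + have := potential_drop (cut h u y) uN Ku.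
    have := potential_cut h K uN yN nuy; rewrite pu /= upd_same.
    move: (m1 y yN); move: (mark h y) (deg h u) d1 leT => mk dg d1 leT.
    nia.
- move=> {}T {leT ok0 t0 us pu K}s [K [[I m1 mx] t0 us pu leT]] /=.
  rewrite negbK leqn0 us => /eqP hu.
  split=> [|T' leT']; first by lia.
  exists K; split=> //; last by lia.
  by split=> //; exact: (inv_close I uN hu).
Qed.

Lemma cascade_cost :
  (bcost (BNot (iszero (IGet PARENT (var vY))))).+1 + ctime cascade_body <= unit_cost.
Proof. by apply: leq_trans (svalP unit_cost_subproof); vm_compute. Qed.

(** In the loop, the node vY may have two marks: they pay for its cut.  At the
    start it may have fewer, hence the 8 units of [debt]. *)
Lemma cascade_spec act s f K y0 T T0 :
  heap_ok N act (reals s KEY) (heap_of s) f K ->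
  (forall d, tab (heap_of s) d = 0) -> ints s vY 0 = y0 -> y0 < N ->
  potential (heap_of s) K + 9 * unit_cost + T0 <= T ->
  wp cascade T s (fun T' s' =>
    [/\ heap_ok N act (reals s' KEY) (heap_of s') f K,
        forall d, tab (heap_of s') d = 0,
        par (heap_of s') y0 = 0 &
        potential (heap_of s') K + T0 <= T']).
Proof.
move=> [I m1 mx] t0 ys yN leT.
pose debt h y := if (par h y == 0) || (mark h y == 2) then 0 else 8 * unit_cost.
apply: (wp_while_straight (I := fun T s => exists y,
   [/\ ints s vY 0 = y /\ y < N,
      [/\ heap_inv N N act (reals s KEY) (heap_of s) f K,
          tabmax (heap_of s) < B, mark (heap_of s) y <= 2 &
          forall z, z < N -> z != y -> mark (heap_of s) z <= 1],
      forall d, tab (heap_of s) d = 0,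
      par (heap_of s) y0 = 0 \/ y = y0 &
      potential (heap_of s) K + debt (heap_of s) y + unit_cost + T0 <= T])
  _ cascade_cost) => //.
- exists y0; split=> //; last 1 first.
  + by rewrite /debt; case: ifP => _; lia.
  + split=> // [|z zN _]; [exact: leq_trans (m1 _ yN) _ | exact: m1].
  + by right.
- move=> {}T {leT t0 ys yN I m1 mx}s [y [[ys yN] [I mx m2 m1] t0 y0P leT]].
  rewrite [beval _ _]/= leqn0 ys -[ints s PARENT y]/(par (heap_of s) y) => py.
  split=> [|T' leT']; first by lia.
  have [x px] : exists x, par (heap_of s) y = x.+1.
    by case: (par (heap_of s) y) py => // x _; exists x.
  rewrite /cascade_body 2!den_seq.
  set s1 := den _ s.
  have Ps1 : ints s1 vP 0 = x.
    by rewrite -[x]subn0 -subSS -px -ys subn1 -subn1.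
  have ys1 : ints s1 vY 0 = y by rewrite -ys.
  have rs1 : reals s1 = reals s by [].
  have hs1 : heap_of s1 = heap_of s by [].
  have := reals_cut s1; have := heap_cut s1.
  have : ints (den cut_code s1) vY 0 = y by rewrite vars_cut.
  have : ints (den cut_code s1) vP 0 = x by rewrite vars_cut.
  rewrite hs1 rs1 Ps1 ys1.
  move: (den cut_code s1) => s2 Ps2 ys2 hs2 rs2.
  have ms2 : ints s2 MARK = mark (heap_of s2) by [].
  rewrite den_if [beval _ _]/= Ps2 ms2 hs2.
  move: (heap_of s) => h in I m1 mx t0 m2 y0P leT py px hs1 hs2 {ms2} *.
  have [xN ay ax kyx fyx] := inv_par I yN px.
  have nxy : x != y by apply: contraTneq fyx => ->; rewrite ltnn.
  have I' := inv_cut I yN px t0.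
  have potE := potential_cut h K xN yN nxy.
  have debtE : debt h y + 4 * unit_cost * mark h y >= 8 * unit_cost.
    rewrite /debt px /=; case: eqP => [->|_] /=; first lia.
    exact: leq_addr.
  have mxE : mark (cut h x y) x = mark h x + (par h x != 0).
    rewrite /= upd_other //; case: eqP => _ /=; last by rewrite upd_same addn1.
    by rewrite addn0.
  have mzE z : z < N -> z != x -> mark (cut h x y) z <= 1.
    move=> zN nzx; rewrite /= /upd; case: (z =P y) => // /eqP nzy.
    by case: eqP => _; rewrite ?(negPf nzx); exact: m1.
  have y0E : par (cut h x y) y0 = 0.
    rewrite /= /upd; case: eqP => // ne; by case: y0P => // e; case: ne.
  have m1x := m1 x xN nxy.
  case: ifP => [m2x|/negbT].
    have -> : reals (den (setv vY (var vP)) s2) = reals s by [].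
    have -> : heap_of (den (setv vY (var vP)) s2) = cut h x y by rewrite -hs2.
    exists x; split=> //.
    + split=> //; rewrite mxE; by case: (_ != 0); lia.
    + by left.
    + move: mxE m2x; rewrite /debt; case: (mark _ _ =P 2) => [_|]; last by lia.
      rewrite orbT addn0; move: potE; case: (par h x != 0) => /=; lia.
  rewrite -ltnNge => m2x; rewrite [den Skip s2]/= rs2 hs2.
  exists y; split=> //.
  + split=> //; first by rewrite /= upd_same.
    move=> z zN _; have [->//|nzx] := eqVneq z x; exact: mzE.
  + by left.
  + rewrite {1}/debt /= upd_same /= addn0.
    move: potE; case: (par h x != 0) => /=; lia.
- move=> {}T {leT t0 ys yN I m1 mx}s [y [[ys yN] [I mx m2 m1] t0 y0P leT]].
  rewrite [beval _ _]/= negbK leqn0 ys -[ints s PARENT y]/(par (heap_of s) y) => /eqP py.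
  split=> [|T' leT']; first by lia.
  split=> //; [split=> // z zN | by case: y0P => // <- | by lia].
  have [->|] := eqVneq z y; last exact: m1.
  by rewrite (inv_mark I).
Qed.

End HeapCode.

(** * Dijkstra's algorithm *)

Section Search.
Context {R : realType}.
Variables (N : nat) (G : nat -> seq nat) (tgt : nat -> nat -> nat)
  (wt : nat -> R) (src : nat).
Hypothesis srcN : src < N.
Hypothesis tgtN : forall u e, u < N -> e \in G u -> tgt u e < N.
Hypothesis wt_le0 : forall u e, u < N -> e \in G u -> (wt e <= 0)%R.
Implicit Types (s : memory R) (fl : nat -> nat) (key : nat -> R)
  (D : nat -> bool) (u : nat) (l : seq nat).

(** The arcs leaving [u] are [G u]; the head of [e] depends on [u] because the
    same arc occurs in every layer. *)
Inductive reach : nat -> R -> Prop :=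
  | reach_src : reach src 0%R
  | reach_arc u w e : reach u w -> e \in G u -> reach (tgt u e) (w + wt e)%R.

Lemma reachN v w : reach v w -> v < N.
Proof. by elim=> // u w' e _ uN eG; apply: tgtN. Qed.

(** [D] are the nodes extracted so far.  The arcs [l] of the node [u] extracted
    last have not been treated yet; [u = N] stands for no such node. *)
Record dij fl key D u l : Prop := Dij {
  dij_reach : forall v, v < N -> fl v != 0 -> reach v (key v);
  dij_src : fl src != 0 /\ (0 <= key src)%R;
  dij_done : forall x, D x -> x < N /\ fl x != 0;
  dij_mono : forall x v, D x -> v < N -> fl v != 0 -> ~~ D v ->
    (key v <= key x)%R;
  dij_last : forall x, u < N -> D x -> (key u <= key x)%R;
  dij_relaxed : forall x e, D x -> e \in G x ->
    (x = u /\ e \in l) \/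
    (fl (tgt x e) != 0 /\ (key x + wt e <= key (tgt x e))%R)
}.

Definition active fl D v : bool := [&& v < N, fl v != 0 & ~~ D v].

Lemma dij_extract fl key D u : dij fl key D N [::] -> active fl D u ->
  (forall v, active fl D v -> (key v <= key u)%R) ->
  dij fl key (fun x => D x || (x == u)) u (G u).
Proof.
move=> [d1 d2 d3 d4 d5 d6] /and3P[uN fu nDu] maxu; split=> //.
- by move=> x /orP[/d3//|/eqP->].
- move=> x v /orP[Dx|/eqP->] vN fv; rewrite negb_or => /andP[nDv nvu].
    exact: d4.
  by apply: maxu; apply/and3P.
- by move=> x _ /orP[Dx|/eqP->//]; apply: d4.
- move=> x e /orP[Dx|/eqP->] eG; last by left.
  by case: (d6 x e Dx eG) => [[]//|?]; right.
Qed.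

Lemma dij_close fl key D u : dij fl key D u [::] -> dij fl key D N [::].
Proof.
move=> [d1 d2 d3 d4 d5 d6]; split=> //; first by move=> x; rewrite ltnn.
by move=> x e Dx /(d6 x e Dx)[[]//|?]; right.
Qed.

(** The offered key [c] is at most [key u], as weights are not positive, and
    [key u] is at most the key of any extracted node.  So the keys of extracted
    nodes never change. *)
Lemma dij_relax fl key fl' key' D u e l (v := tgt u e) (c := (key u + wt e)%R) :
  dij fl key D u (e :: l) -> D u -> e \in G u ->
  (forall x, x != v -> fl' x = fl x /\ key' x = key x) -> fl' v != 0 ->
  [\/ fl v = 0 /\ key' v = c,
      fl v != 0 /\ (c <= key v)%R /\ key' v = key v |
      fl v != 0 /\ (key v < c)%R /\ key' v = c] ->
  dij fl' key' D u l.
Proof.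
move=> [d1 d2 d3 d4 d5 d6] Du eG same fv kv.
have [uN fu] := d3 u Du.
have vN : v < N by apply: tgtN.
have cu : (c <= key u)%R by rewrite /c gerDl; apply: (wt_le0 uN eG).
have rc : reach v c by apply: reach_arc => //; apply: d1.
have keyD x : D x -> key' x = key x.
  move=> Dx; have [ex|nx] := eqVneq x v; last by case: (same x nx).
  rewrite ex in Dx *; have [_ fvn] := d3 v Dx.
  case: kv => [[f0]|[_ []//]|[_ [lt _]]]; first by rewrite f0 in fvn.
  by have := lt_le_trans lt cu; rewrite ltNge d5.
have keyc : (c <= key' v)%R by case: kv => [[_ ->]|[_ [? ->]]|[_ [_ ->]]].
have flx x : fl x != 0 -> fl' x != 0.
  by have [->//|nx] := eqVneq x v; case: (same x nx) => ->.
have keyx x : fl x != 0 -> (key x <= key' x)%R.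
  have [->|nx] := eqVneq x v; last by case: (same x nx) => _ ->.
  by case: kv => [[-> //]|[_ [_ ->]]|[_ [lt ->]]] // _; exact: ltW.
split.
- move=> x xN; have [->|nx] := eqVneq x v.
    move=> _; case: kv => [[_ ->//]|[f0 [_ ->]]|[_ [_ ->]]] //; exact: d1.
  by case: (same x nx) => -> ->; exact: d1.
- have [f0 k0] := d2; split; first exact: flx.
  exact: le_trans (keyx _ f0).
- by move=> x /d3[xN /flx].
- move=> x z Dx zN fz nDz; rewrite (keyD x Dx).
  have [ez|nz] := eqVneq z v; last first.
    by move: fz; case: (same z nz) => -> -> fz; exact: d4.
  rewrite ez in nDz *; have ck : (c <= key x)%R by apply: le_trans cu (d5 _ _ Dx).
  case: kv => [[_ ->//]|[f0 [_ ->]]|[_ [_ ->]]] //; exact: d4.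
- by move=> x _ Dx; rewrite !keyD //; exact: d5.
- move=> x e' Dx eG'; rewrite (keyD x Dx).
  case: (d6 x e' Dx eG') => [[ex]|[ft kt]]; last first.
    by right; split; [exact: flx | exact: le_trans (keyx _ ft)].
  rewrite inE => /orP[/eqP ee|]; last by left.
  by right; rewrite ex ee.
Qed.

(** At the end all the reached nodes are extracted, and the set of reached nodes
    is closed under arcs.  The bound follows by induction on the path. *)
Lemma dij_final fl key D : dij fl key D N [::] ->
  (forall v, ~~ active fl D v) -> forall v, v < N ->
  (fl v != 0 -> reach v (key v)) /\
  (forall w, reach v w -> fl v != 0 /\ (w <= key v)%R).
Proof.
move=> [d1 d2 d3 d4 d5 d6] na v vN; split; first exact: d1.
move=> w; elim=> // {w}x w e rx [fx lex] eG.
have Dx : D x.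
  by have := na x; rewrite /active (reachN rx) fx negbK.
case: (d6 x e Dx eG) => [[_]//|[ft lt]]; split=> //.
by apply: le_trans lt; rewrite lerD2r.
Qed.

(** The lists of the layered graph are not stored: the list of a node serves all
    its copies, and the layer of the head is added when an arc is read. *)
Definition graph_in s : Prop := forall u, u < N ->
  chain (ints s ARC_NEXT) (ints s ARCS (u - ints s LAYER u)) (G u) /\
  forall e, e \in G u -> tgt u e = ints s ARC_HEAD e + ints s NEXT_LAYER u /\
                         reals s WEIGHT e = wt e.

Definition graph_arrays : seq nat := [:: ARC_NEXT; ARCS; LAYER; ARC_HEAD; NEXT_LAYER].

Lemma graph_in_frame p s s' : same_outside p s s' ->
  all (fun a => a \notin iwrites p) graph_arrays -> WEIGHT \notin rwrites p ->
  graph_in s -> graph_in s'.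
Proof.
move=> [fi fr] /allP out wp_ gs u uN; have [ch tg] := gs u uN.
have E a : a \in graph_arrays -> ints s' a = ints s a.
  by move=> /out na; apply/funext => k; exact: fi.
have -> : reals s' WEIGHT = reals s WEIGHT by apply/funext => k; exact: fr.
by rewrite !E.
Qed.

Lemma relax_cost : (bcost (BNot (iszero (var vE)))).+1 + ctime arc_code
   + ctime improve_code <= unit_cost.
Proof. by apply: leq_trans (svalP unit_cost_subproof); vm_compute. Qed.

Lemma arc_spec s s' u e l : s' = den arc_code s -> graph_in s -> u < N ->
  ints s vU 0 = u -> e \in G u -> chain (ints s ARC_NEXT) (ints s vE 0) (e :: l) ->
  [/\ heap_of s' = heap_of s, reals s' KEY = reals s KEY,
      ints s' REACHED = ints s REACHED & ints s' vU 0 = u] /\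
  [/\ ints s' vV 0 = tgt u e, reals s' CANDIDATE 0 = (reals s KEY u + wt e)%R,
      chain (ints s ARC_NEXT) (ints s' vE 0) l &
      ints s' vY 0 = if (reals s KEY u + wt e <= reals s KEY (tgt u e))%R
        then u else tgt u e].
Proof.
move=> -> gs uN us eG [es ch].
have [_ /(_ e eG) [te we]] := gs u uN.
rewrite /arc_code !den_seq.
set s1 := den _ (den _ (den _ s)).
have us1 : ints s1 vU 0 = u by rewrite -us.
have e1 : ints s vE 0 - 1 = e by rewrite es subn1.
have vs1 : ints s1 vV 0 = tgt u e by rewrite te -us -e1.
have cs1 : reals s1 CANDIDATE 0 = (reals s KEY u + wt e)%R by rewrite -we -us -e1.
have ens1 : ints s1 vE 0 = ints s ARC_NEXT e by rewrite -e1.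
have ks1 : reals s1 KEY = reals s KEY by [].
have hs1 : heap_of s1 = heap_of s by [].
have fs1 : ints s1 REACHED = ints s REACHED by [].
move: s1 us1 vs1 cs1 ens1 ks1 hs1 fs1 => s1 us1 vs1 cs1 ens1 ks1 hs1 fs1.
rewrite den_if [beval _ _]/= cs1 vs1 ks1.
have chs1 : chain (ints s ARC_NEXT) (ints s1 vE 0) l by rewrite ens1.
by case: ifP => _; split; split.
Qed.

Lemma improve_spec s s' v c : s' = den improve_code s ->
  ints s vV 0 = v -> reals s CANDIDATE 0 = c ->
  [\/ [/\ ints s REACHED v = 0, heap_of s' = push (heap_of s) v,
          ints s' REACHED = upd (ints s REACHED) v 1 &
          reals s' KEY = upd (reals s KEY) v c],
      [/\ ints s REACHED v != 0, (c <= reals s KEY v)%R & s' = s] |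
      [/\ ints s REACHED v != 0 /\ (reals s KEY v < c)%R, heap_of s' = heap_of s,
          ints s' REACHED = ints s REACHED &
          reals s' KEY = upd (reals s KEY) v c]].
Proof.
move=> -> vs cs; rewrite /improve_code !den_if [beval _ _]/= [beval _ _]/= leqn0 vs.
case: eqP => [f0|/eqP f0].
  by apply: Or31; split=> //; rewrite -?vs -?cs.
rewrite cs; case: leP => [le|lt]; first by apply: Or32.
by apply: Or33; split=> //; rewrite -?vs -?cs.
Qed.

Lemma heap_ok_eq b act act' key h f K : act =1 act' ->
  heap_ok N b act key h f K -> heap_ok N b act' key h f K.
Proof. by move=> /funext->. Qed.

(** An arc costs 14 units: 1 for its own commands, 9 for the cascade and 3 for a
    possible new root, with one to spare. *)
Lemma relax_spec s u D f K T T0 :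
  graph_in s -> ints s vU 0 = u -> u < N -> D u ->
  chain (ints s ARC_NEXT) (ints s vE 0) (G u) ->
  heap_ok N N (active (ints s REACHED) D) (reals s KEY) (heap_of s) f K ->
  (forall d, tab (heap_of s) d = 0) ->
  dij (ints s REACHED) (reals s KEY) D u (G u) ->
  potential N (heap_of s) K + 14 * unit_cost * size (G u) + unit_cost + T0 <= T ->
  wp relax T s (fun T' s' =>
    [/\ heap_ok N N (active (ints s' REACHED) D) (reals s' KEY) (heap_of s') f K,
        forall d, tab (heap_of s') d = 0,
        dij (ints s' REACHED) (reals s' KEY) D N [::] &
        potential N (heap_of s') K + T0 <= T']).
Proof.
move=> gs us uN Du ch ok t0 ds leT.
apply: (wp_while (I := fun T s => exists l,
   [/\ [/\ graph_in s, ints s vU 0 = u, {subset l <= G u} &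
           chain (ints s ARC_NEXT) (ints s vE 0) l],
       heap_ok N N (active (ints s REACHED) D) (reals s KEY) (heap_of s) f K,
       forall d, tab (heap_of s) d = 0,
       dij (ints s REACHED) (reals s KEY) D u l &
       potential N (heap_of s) K + 14 * unit_cost * size l + unit_cost + T0 <= T])).
- by exists (G u); split=> //; split.
- move=> {}T {leT gs us ch ok t0 ds}s [l [[gs us lG ch] ok t0 ds leT]].
  rewrite [beval _ _]/= => nz.
  have cost := relax_cost.
  move: cost; set gc := (bcost _).+1 => cost.
  split; first lia.
  case: l lG ch ds leT => [|e l] lG ch ds leT; first by rewrite ch in nz.
  have eG : e \in G u by apply: lG; rewrite inE eqxx.
  have vN : tgt u e < N by apply: tgtN.
  set p := (arc_code ;; _).
  suff H : wp p (T - gc) s (fun T' s' =>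
      [/\ ints s' vU 0 = u, chain (ints s ARC_NEXT) (ints s' vE 0) l,
       heap_ok N N (active (ints s' REACHED) D) (reals s' KEY) (heap_of s') f K,
       forall d, tab (heap_of s') d = 0 &
       dij (ints s' REACHED) (reals s' KEY) D u l /\
       potential N (heap_of s') K + 14 * unit_cost * size l + unit_cost + T0 <= T']).
    apply: wp_mono (wp_frame H) _ => T' s' [[us' ch' ok' t0' [ds' le']] fr].
    have gs' : graph_in s' by apply: graph_in_frame fr _ _ gs.
    exists l; split=> //; split=> //.
      by move=> e' e'l; apply: lG; rewrite inE e'l orbT.
    suff -> : ints s' ARC_NEXT = ints s ARC_NEXT by [].
    by apply/funext => k; apply: (proj1 fr).
  apply: wp_seq; apply: wp_straight => //; first lia.
  move: (arc_spec erefl gs uN us eG ch); move: (den arc_code s) => s1.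
  move=> [[hs1 ks1 fs1 us1] [vs1 cs1 es1 ys1]].
  rewrite -hs1 -ks1 -fs1 in ok t0 ds leT cs1 ys1 *.
  rewrite ks1 -ks1 in ys1.
  set y0 := ints s1 vY 0.
  have y0N : y0 < N by rewrite /y0 ys1; case: ifP.
  apply: wp_seq.
  have {}leT : potential N (heap_of s1) K + 9 * unit_cost +
      (5 * unit_cost + 14 * unit_cost * size l + unit_cost + T0 - unit_cost) <= T - gc - ctime arc_code - 0.
    move: leT cost; rewrite /= mulnS; lia.
  rewrite subn0 in leT.
  have H := cascade_spec ok t0 (erefl y0) y0N leT.
  apply: wp_mono (wp_frame H) _ => T1 s2 [[ok2 t2 py2 leT2] [fi fr]].
  have fs2 : ints s2 REACHED = ints s1 REACHED by apply/funext => k; exact: fi.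
  have us2 : ints s2 vU 0 = u by rewrite fi.
  have vs2 : ints s2 vV 0 = tgt u e by rewrite fi.
  have es2 : ints s2 vE 0 = ints s1 vE 0 by rewrite fi.
  have cs2 : reals s2 CANDIDATE 0 = (reals s1 KEY u + wt e)%R by rewrite fr.
  have ks2 : reals s2 KEY = reals s1 KEY by apply/funext => k; exact: fr.
  rewrite -fs2 -ks2 -es2 in ok2 ds cs2 ys1 es1.
  move: cs2 ys1; set v := tgt u e; set c := (reals s2 KEY u + wt e)%R => cs2 ys1.
  apply: wp_straight => //; first lia.
  set s3 := den improve_code s2.
  have fr3 : same_outside improve_code s2 s3 by exact: den_frame.
  have us3 : ints s3 vU 0 = u by rewrite (frame_ints fr3).
  have es3 : ints s3 vE 0 = ints s2 vE 0 by rewrite (frame_ints fr3).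
  case: ok2 => I m1 mx.
  rewrite us3 es3.
  have nDv : ints s2 REACHED v = 0 -> ~~ D v.
    by move=> fv; apply/negP => /(dij_done ds)[_]; rewrite fv.
  case: (improve_spec (erefl s3) vs2 cs2).
  - move=> [fv hs3 fs3 ks3]; rewrite hs3 fs3 ks3.
    have nav : ~~ active (ints s2 REACHED) D v by rewrite /active fv andbF.
    have nNv : N != v by rewrite neq_ltn vN orbT.
    have pv : par (heap_of s2) v = 0.
      case E : (par (heap_of s2) v) => [//|q].
      by have [_ av] := inv_par I vN E; rewrite av in nav.
    have nch y : y < N -> par (heap_of s2) y <> v.+1.
      move=> yN /(inv_par I yN)[_ _]; rewrite (negPf nav) /= eq_sym.
      by rewrite (negPf nNv).
    split=> //.
    + apply: (@heap_ok_eq _ (fun x => active (ints s2 REACHED) D x || (x == v))).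
        move=> x; rewrite /active /upd; case: (x =P v) => [->|_]; last by rewrite orbF.
        by rewrite orbT vN nDv.
      split=> //; apply: inv_push => //.
      apply: (inv_key I pv) => [x nx|y yN /nch //]; first by rewrite upd_other.
    + split; last by rewrite potential_push; lia.
      apply: (dij_relax ds) => //.
      * by move=> x nx; rewrite !upd_other.
      * by rewrite upd_same.
      * by apply: Or31; rewrite upd_same.
  - move=> [fv le ->]; split=> //; split; last by lia.
    by apply: (dij_relax ds) => //; apply: Or32.
  move=> [[fv lt] hs3 fs3 ks3]; rewrite hs3 fs3 ks3.
  have y0v : y0 = v by rewrite /y0 ys1 leNgt lt.
  split=> //.
  - split=> //; apply: (@inv_key _ _ _ _ _ _ _ _ _ v I) => [|x nx|y yN /(inv_par I yN)[_ _ _ le _]].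
    + by rewrite -y0v.
    + by rewrite upd_other.
    + by rewrite upd_same; apply: (le_trans le (ltW lt)).
  - split; last by lia.
    apply: (dij_relax ds) => //; first by move=> x nx; rewrite upd_other.
    by apply: Or33; rewrite upd_same.
- move=> {}T {leT gs us ch ok t0 ds}s [l [[gs us lG ch] ok t0 ds leT]].
  rewrite [beval _ _]/= negbK leqn0 => /eqP e0.
  have cost := relax_cost; set gc := (bcost _).+1 in cost *.
  split; first lia.
  case: l lG ch ds leT => [|e l] lG ch ds leT; last by case: ch; rewrite e0.
  split=> //; first exact: dij_close ds.
  by rewrite muln0 in leT; lia.
Qed.

Local Notation B := (deg_bound N).

Definition undone D : nat := \sum_(x < N) ~~ D x.
Definition arcs_left D : nat := \sum_(x < N) (if D x then 0 else size (G x)).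

(** For each node to be extracted, 5 units for each possible degree (2 to collect
    the roots, 3 to release the children) and a constant. *)
Definition search_credit D : nat :=
  unit_cost * (5 * B + 10) * undone D + 14 * unit_cost * arcs_left D.

Lemma search_credit_extract D u (D' := fun x => D x || (x == u)) :
  u < N -> ~~ D u ->
  search_credit D' + unit_cost * (5 * B + 10) + 14 * unit_cost * size (G u)
    = search_credit D.
Proof.
move=> uN nDu; have D'u : D' u by rewrite /D' eqxx orbT.
have E1 : undone D' + 1 = undone D + 0.
  have := @sum_change N (fun x => ~~ D x : nat) (fun x => ~~ D' x : nat) u uN.
  rewrite nDu D'u /=; apply=> x _ /negPf nx.
  by rewrite /D' nx orbF.
have E2 : arcs_left D' + size (G u) = arcs_left D + 0.
  have := @sum_change N (fun x => if D x then 0 else size (G x))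
    (fun x => if D' x then 0 else size (G x)) u uN.
  rewrite (negPf nDu) D'u /=; apply=> x _ /negPf nx.
  by rewrite /D' nx orbF.
rewrite /search_credit -[undone D]addn0 -E1 -[arcs_left D]addn0 -E2.
by rewrite !mulnDr muln1; lia.
Qed.

Lemma extract_spec s : 0 < top (heap_of s) ->
  ints (den extract_code s) vU 0 = stk (heap_of s) (top (heap_of s)).-1 /\
  heap_of (den extract_code s) = pop (heap_of s).
Proof. by move=> t0; rewrite /pop -!subn1. Qed.

Lemma code_costs :
  [/\ (bcost (BNot (iszero (var TOP)))).+1 <= unit_cost,
      ctime (setv vD (INum 0)) <= unit_cost,
      ctime extract_code <= unit_cost & ctime first_arc_code <= unit_cost].
Proof. by split; apply: leq_trans (svalP unit_cost_subproof); vm_compute. Qed.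

(** The heap is empty at the end and satisfies its invariant, so that the next
    search can start from it; the potential left over passes to that search. *)
Lemma search_spec s D f K T T0 :
  graph_in s ->
  heap_ok N N (active (ints s REACHED) D) (reals s KEY) (heap_of s) f K ->
  (forall d, tab (heap_of s) d = 0) ->
  dij (ints s REACHED) (reals s KEY) D N [::] ->
  potential N (heap_of s) K + search_credit D + unit_cost + T0 <= T ->
  wp search T s (fun T' s' => exists f K,
    [/\ heap_ok N N xpred0 (reals s' KEY) (heap_of s') f K,
        forall d, tab (heap_of s') d = 0,
        potential N (heap_of s') K + T0 <= T' &
        forall v, v < N ->
          (ints s' REACHED v != 0 -> reach v (reals s' KEY v)) /\
          (forall w, reach v w -> ints s' REACHED v != 0 /\ (w <= reals s' KEY v)%R)]).
Proof.
have [c1 c2 c3 c4] := code_costs.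
move=> gs ok t0 ds leT.
apply: (wp_while (I := fun T s => exists D f K,
   [/\ graph_in s,
       heap_ok N N (active (ints s REACHED) D) (reals s KEY) (heap_of s) f K,
       forall d, tab (heap_of s) d = 0,
       dij (ints s REACHED) (reals s KEY) D N [::] &
       potential N (heap_of s) K + search_credit D + unit_cost + T0 <= T])).
- by exists D, f, K.
- move=> {gs ok t0 ds leT K f D}{}T {}s [D [f [K [gs ok t0 ds leT]]]].
  rewrite [beval _ _]/= leqn0 -lt0n -[ints s TOP 0]/(top (heap_of s)) => tp.
  split; first lia.
  set T1 := T - _; have leT1 : T <= T1 + unit_cost by rewrite /T1; lia.
  move: T1 leT1 => T1 leT1 {c1}.
  set CR := search_credit D in leT *.
  (* the stack is not empty, hence some node is active *)
  have [x ax] : exists x, active (ints s REACHED) D x.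
    by have [_ ax _ _ _] := top_root (ok_inv ok) tp erefl; eexists; exact: ax.
  suff H : wp search_body T1 s (fun T' s' => exists D f K,
     [/\ heap_ok N N (active (ints s' REACHED) D) (reals s' KEY) (heap_of s') f K,
       forall d, tab (heap_of s') d = 0,
       dij (ints s' REACHED) (reals s' KEY) D N [::] &
       potential N (heap_of s') K + search_credit D + unit_cost + T0 <= T']).
    apply: wp_mono (wp_frame H) _ => T' s' [[D' [f' [K' [ok' t0' ds' le']]]] fr].
    by exists D', f', K'; split=> //; apply: graph_in_frame fr _ _ gs.
  apply: wp_seq.
  have [q eq1] : exists q, unit_cost * B = q by eexists.
  have eq2 : unit_cost * (5 * B + 10) = 5 * q + 10 * unit_cost by rewrite -eq1; lia.
  have eq3 : 2 * unit_cost * B = 2 * q by rewrite -eq1; lia.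
  have [C eC] : exists C, CR = C + (5 * q + 10 * unit_cost).
    case/and3P: ax => xN _ nDx; have := search_credit_extract xN nDx.
    rewrite eq2 -/CR => <-; eexists; rewrite addnAC; reflexivity.
  rewrite eC in leT.
  have le1 : potential N (heap_of s) K + unit_cost + (C + 5 * q + 9 * unit_cost + T0) <= T1.
    by lia.
  apply: wp_mono (wp_frame (consolidate_spec ok le1)) _ => {T1 le1 leT1}T1 s1.
  move=> [[f1 [K1 [ok1 tp1 le1]]] [fi1 fr1]].
  have fl1 : ints s1 REACHED = ints s REACHED by apply/funext => k; exact: fi1.
  have ks1 : reals s1 KEY = reals s KEY by apply/funext => k; exact: fr1.
  have gs1 : graph_in s1 by apply: graph_in_frame (conj fi1 fr1) _ _ gs.
  rewrite -fl1 in ok1 ax ds; rewrite -ks1 in ds.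
  clear gs ok t0 leT tp fl1 ks1 fi1 fr1 s f K T.
  apply: wp_seq; apply: wp_straight_le (c2) _ _ => //; first lia.
  move=> T2 leT2; set s2 := den _ s1.
  have hs2 : heap_of s2 = heap_of s1 by [].
  have fl2 : ints s2 REACHED = ints s1 REACHED by [].
  have ks2 : reals s2 = reals s1 by [].
  have d2 : ints s2 vD 0 = 0 by [].
  have gs2 : graph_in s2 by [].
  rewrite -fl2 -ks2 -hs2 in ok1 ax ds tp1 le1.
  move: s2 d2 gs2 {hs2 fl2 ks2} ok1 ax ds tp1 le1 => s2 d2 gs2 ok2 ax ds tp2 le2.
  clear gs1 s1.
  have {}le2 : potential N (heap_of s2) K1 + 2 * unit_cost * B + unit_cost +
      (C + 3 * q + 7 * unit_cost + T0) <= T2 by rewrite eq3; lia.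
  apply: wp_seq.
  apply: wp_mono (wp_frame (collect_spec ok2 tp2 d2 le2)) _ => {leT2}T3 s3.
  move=> [[ok3 t3 tm3 le3] [fi3 fr3]].
  have fl3 : ints s3 REACHED = ints s2 REACHED by apply/funext => k; exact: fi3.
  have ks3 : reals s3 KEY = reals s2 KEY by apply/funext => k; exact: fr3.
  have gs3 : graph_in s3 by apply: graph_in_frame (conj fi3 fr3) _ _ gs2.
  rewrite -fl3 in ok3 ax ds; rewrite -ks3 in ds.
  clear gs2 ok2 tp2 d2 le2 fl3 ks3 fi3 fr3 s2.
  have above v : active (ints s3 REACHED) D v -> exists2 i, i < top (heap_of s3) &
      (reals s3 KEY v <= reals s3 KEY (stk (heap_of s3) i))%R.
    move=> av; have [r [rN ar pr le]] := root_above (ok_inv ok3) av.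
    have [i it er] := root_in_stack (ok_inv ok3) t3 rN ar pr.
    by exists i; rewrite ?er.
  have tp3 : 0 < top (heap_of s3) by have [i] := above _ ax; lia.
  apply: wp_seq; apply: wp_straight_le (c3) _ _ => //; first lia.
  move=> T4 leT4.
  have [us4 hs4] := extract_spec tp3.
  have fl4 : ints (den extract_code s3) REACHED = ints s3 REACHED by [].
  have ks4 : reals (den extract_code s3) = reals s3 by [].
  have gs4 : graph_in (den extract_code s3) by [].
  move: (den extract_code s3) us4 hs4 fl4 ks4 gs4 => s4 us4 hs4 fl4 ks4 gs4.
  case: ok3 => I3 m3 mx3.
  set u := ints s4 vU 0 in us4.
  have [uN au pu _ _] := top_root I3 tp3 us4.
  have maxu v : active (ints s3 REACHED) D v -> (reals s3 KEY v <= reals s3 KEY u)%R.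
    move=> /above[i it le]; apply: (le_trans le); rewrite us4; exact: tm3.
  have ds4 := dij_extract ds au maxu.
  set D' := (fun x => D x || (x == u)) in ds4.
  have ok4 : heap_ok N u (active (ints s4 REACHED) D') (reals s4 KEY) (heap_of s4) f1 K1.
    rewrite hs4 ks4 fl4.
    apply: (@heap_ok_eq _ (fun x => active (ints s3 REACHED) D x && (x != u))).
      by move=> x'; rewrite /active /D' negb_or !andbA.
    by split=> //; apply: inv_pop.
  have t4 d : tab (heap_of s4) d = 0 by rewrite hs4; exact: t3.
  have pu4 : par (heap_of s4) u = 0 by rewrite hs4; exact: pu.
  have du4 : deg (heap_of s4) u < B by rewrite hs4; exact: (deg_lt I3).
  rewrite -fl4 -ks4 in ds4.
  have le4 : potential N (heap_of s4) K1 + 3 * unit_cost * deg (heap_of s4) u + unit_cost +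
      (C + 5 * unit_cost + T0) <= T4.
    have := potential_pop N K1 tp3; rewrite -hs4.
    have : 3 * unit_cost * deg (heap_of s4) u <= 3 * q.
      by rewrite -eq1 -mulnA leq_mul2l leq_mul2l (ltnW du4) !orbT.
    by lia.
  have {}eC : search_credit D' + 14 * unit_cost * size (G u) = C.
    have := @search_credit_extract D u uN; rewrite -/CR eC eq2 -/D'.
    by case/and3P: au => _ _ nDu /(_ nDu); lia.
  clear gs3 tm3 le3 above tp3 leT4 fl4 ks4 m3 mx3 maxu pu au I3 ds t3 hs4 us4 ax x.
  clear T3 s3.
  apply: wp_seq.
  apply: wp_mono (wp_frame (release_spec ok4 t4 uN erefl pu4 le4)) _ => {le4}T5 s5.
  move=> [[K5 [ok5 t5 le5]] [fi5 fr5]].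
  have fl5 : ints s5 REACHED = ints s4 REACHED by apply/funext => k; exact: fi5.
  have ks5 : reals s5 KEY = reals s4 KEY by apply/funext => k; exact: fr5.
  have us5 : ints s5 vU 0 = u by rewrite fi5.
  have gs5 : graph_in s5 by apply: graph_in_frame (conj fi5 fr5) _ _ gs4.
  rewrite -fl5 -ks5 in ds4; rewrite -fl5 in ok5.
  apply: wp_seq; apply: wp_straight_le (c4) _ _ => //; first lia.
  move=> T6 leT6; set s6 := den _ s5.
  have ch6 : chain (ints s6 ARC_NEXT) (ints s6 vE 0) (G u).
    have [] := gs5 u uN; rewrite -us5; exact.
  have Du : D' u by rewrite /D' eqxx orbT.
  have le6 : potential N (heap_of s6) K5 + 14 * unit_cost * size (G u) + unit_cost +
       (search_credit D' + unit_cost + T0) <= T6.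
    by have -> : heap_of s6 = heap_of s5 by []; lia.
  apply: wp_mono (relax_spec (s := s6) gs5 us5 uN Du ch6 ok5 t5 ds4 le6) _.
  move=> T7 s7 [ok7 t7 ds7 le7].
  by exists D', f1, K5; split=> //; lia.
- move=> {gs ok t0 ds leT K f D}{}T {}s [D [f [K [gs ok t0 ds leT]]]].
  rewrite [beval _ _]/= negbK leqn0 -[ints s TOP 0]/(top (heap_of s)) => /eqP tp.
  split; first lia.
  have na x : ~~ active (ints s REACHED) D x.
    apply/negP => ax; have [r [rN ar pr _]] := root_above (ok_inv ok) ax.
    by have [i] := root_in_stack (ok_inv ok) t0 rN ar pr; rewrite tp.
  exists f, K; split=> //; last exact: dij_final ds na.
    by apply: heap_ok_eq ok => x; apply/negbTE.
  lia.
Qed.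

End Search.

(** * Paths, powers and the critical circuit *)

Section Paths.
Context {R : realType} {n : nat}.
Implicit Types (A B : 'M[Rmax R]_n) (i j : 'I_n) (p c : seq 'I_n) (w : R).

Lemma path_weight_cat A i p q :
  path_weight A i (p ++ q) = (path_weight A i p + path_weight A (last i p) q)%R.
Proof. by elim: p i => [|j p IH] i /=; rewrite ?add0r // IH addrA. Qed.

Lemma path_weight_rcons A i p j :
  path_weight A i (rcons p j) =
  (path_weight A i p + arc_weight A (last i p) j)%R.
Proof. by rewrite -cats1 path_weight_cat /= addr0. Qed.

Definition walk A q i j w : Prop :=
  exists p, [/\ path (arc A) i p, last i p = j, size p = q & w = path_weight A i p].

Lemma walk_cat A q q' i j k w w' :
  walk A q i j w -> walk A q' j k w' -> walk A (q + q') i k (w + w')%R.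
Proof.
move=> [p [pp lp sp ->]] [p' [pp' lp' sp' ->]]; exists (p ++ p').
by rewrite cat_path last_cat size_cat path_weight_cat lp pp sp sp'; split.
Qed.

Lemma walk0 A i : walk A 0 i i 0%R.
Proof. by exists [::]. Qed.

Lemma walk1 A i j : arc A i j -> walk A 1 i j (arc_weight A i j).
Proof. by move=> a; exists [:: j]; rewrite /= a addr0. Qed.

Lemma walk_rcons A q i j w : walk A q.+1 i j w ->
  exists k w', [/\ walk A q i k w', arc A k j & w = (w' + arc_weight A k j)%R].
Proof.
move=> [p []]; case/lastP: p => // p k.
rewrite rcons_path last_rcons size_rcons path_weight_rcons.
move=> /andP[pp a] ek [sp] ew; rewrite -ek.
exists (last i p), (path_weight A i p); split=> //; by exists p.
Qed.

Lemma walk_tr A q i j w : walk A q i j w -> walk A^T q j i w.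
Proof.
elim: q i j w => [|q IH] i j w.
  by move=> [p [_ lp /size0nil sp ->]]; rewrite sp /= in lp *; rewrite lp; apply: walk0.
move=> /walk_rcons[k [w' [/IH wk a ->]]]; rewrite addrC -add1n.
have -> : arc_weight A k j = arc_weight A^T j k by rewrite /arc_weight mxE.
by apply: walk_cat wk; apply: walk1; rewrite /arc mxE.
Qed.

Lemma walk_trE A q i j w : walk A^T q j i w <-> walk A q i j w.
Proof. by split=> /walk_tr; rewrite ?trmxK. Qed.

Lemma path_weights_modE A l i j w :
  path_weights_mod A l i j w <-> exists2 q, l %| q & walk A q i j w.
Proof.
split=> [[p [pp lp dp ->]]|[q dq [p [pp lp sp ->]]]].
  by exists (size p) => //; exists p.
by exists p; rewrite sp.
Qed.

Lemma Fin_inj : injective (@Fin R).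
Proof. by move=> x y []. Qed.

Lemma rmax_add_le (x y : Rmax R) : rmax_le x (x + y)%R && rmax_le y (x + y)%R.
Proof.
by move: x y => [x|] [y|] //=; rewrite ?lexx ?le_max ?lexx ?orbT.
Qed.

Lemma rmax_le_trans : transitive (@rmax_le R).
Proof. by move=> [x|] [y|] [z|] //=; apply: le_trans. Qed.

(** Together with [rmax_sum_attained]: sums over the max-plus semiring are
    maxima. *)
Lemma rmax_sum_ge (I : finType) (F : I -> Rmax R) (i : I) :
  rmax_le (F i) (\sum_i F i)%R.
Proof. by rewrite (bigD1 i) //=; case/andP: (rmax_add_le (F i) (\sum_(j | j != i) F j)%R). Qed.

Lemma rmax_sum_attained (I : finType) (F : I -> Rmax R) w :
  (\sum_i F i)%R = Fin w -> exists i : I, F i = Fin w.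
Proof.
elim/big_ind: _ => [//|x y IHx IHy|i _ e]; last by exists i.
case: x y IHx IHy => [x|] [y|] //= IHx IHy.
by move=> [e]; move: e; rewrite /Num.max; case: ifP => _ e;
  [apply: IHy | apply: IHx]; rewrite e.
Qed.

Lemma power_walk A q i j w : (A ^+ q)%R i j = Fin w -> walk A q i j w.
Proof.
elim: q j w => [|q IH] j w.
  rewrite expr0 mxE; case: eqP => [->|_] //= [<-]; exact: walk0.
rewrite exprSr mxE => /rmax_sum_attained[k].
case E: ((A ^+ q)%R i k) => [w'|] //; case a: (A k j) => [v|] // [<-].
have -> : v = arc_weight A k j by rewrite /arc_weight a.
rewrite -addn1; apply: walk_cat (IH _ _ E) _.
by apply: walk1; rewrite /arc a.
Qed.

Lemma walk_power A q i j w : walk A q i j w -> rmax_le (Fin w) ((A ^+ q)%R i j).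
Proof.
elim: q j w => [|q IH] j w.
  move=> [p [_ lp /size0nil sp ->]]; rewrite sp /= in lp *.
  by rewrite expr0 mxE lp eqxx mulr1n; exact: (@lexx _ R 0%R).
move=> /walk_rcons[k [w' [/IH le a ->]]]; rewrite exprSr mxE.
apply: rmax_le_trans (rmax_sum_ge _ k).
move: le a; rewrite /arc /arc_weight.
case: ((A ^+ q)%R i k) => [x|] //; case: (A k j) => [y|] //= le _.
by rewrite lerD2r.
Qed.

Lemma is_max_uniq (S : set R) (x y : Rmax R) : is_max S x -> is_max S y -> x = y.
Proof.
case: x y => [x|] [y|] //=.
- move=> [Sx ux] [Sy uy]; congr Some; apply/eqP.
  by rewrite eq_le uy // ux.
- by move=> [Sx _] S0; rewrite S0 in Sx.
- by move=> S0 [Sx _]; rewrite S0 in Sx.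
Qed.

Lemma max_ofP (S : set R) (x : Rmax R) : is_max S x -> max_of S = x.
Proof.
move=> Sx; rewrite /max_of; case: xgetP => [y _ Sy|/(_ x)//].
exact: is_max_uniq Sy Sx.
Qed.

(** An entry of a power of [A ^+ l] is itself the weight of a path whose length
    is a multiple of [l], and it bounds the weights of those of the same
    length. *)
Lemma kleene_starE A l i j (x : Rmax R) : 0 < l ->
  is_max (path_weights_mod A l i j) x -> kleene_star (A ^+ l)%R i j = x.
Proof.
move=> l0 mx; rewrite mxE; apply: max_ofP.
have sub w : (exists k, ((A ^+ l) ^+ k)%R i j = Fin w) -> path_weights_mod A l i j w.
  move=> [k]; rewrite -exprM => /power_walk wk.
  by apply/path_weights_modE; exists (l * k) => //; exact: dvdn_mulr.
case: x mx => [r|] /=; last first.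
  move=> S0; apply/seteqP; split=> // w /sub; by rewrite S0.
move=> [Sr ur]; split; last by move=> w /sub /ur.
have [q /dvdnP[k ek] wk] := (path_weights_modE _ _ _ _ _).1 Sr.
exists k; rewrite -exprM mulnC -ek; have := walk_power wk.
case E: ((A ^+ q)%R i j) => [v|] //= le; congr Some; apply/eqP.
rewrite eq_le le andbT; apply: ur; apply/path_weights_modE.
by exists q; [rewrite ek dvdn_mull | exact: power_walk E].
Qed.

Lemma visualized_le0 A : visualized A -> lambda A = Fin 0%R ->
  forall i j, arc A i j -> (arc_weight A i j <= 0)%R.
Proof.
move=> vA lA i j; have := vA i j; rewrite lA /arc /arc_weight.
by case: (A i j).
Qed.

Lemma path_weight_le0 A : (forall i j, arc A i j -> (arc_weight A i j <= 0)%R) ->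
  forall i p, path (arc A) i p -> (path_weight A i p <= 0)%R.
Proof.
move=> le0 i p; elim: p i => [|j p IH] i //= /andP[a pp].
by rewrite -[0%R]addr0; apply: lerD; [exact: le0 | exact: IH].
Qed.

Lemma circuit_weight0 A c : lambda A = Fin 0%R -> critical A c ->
  circuit_weight A c = 0%R.
Proof.
move=> lA [/andP[c0 _]]; rewrite lA => /Fin_inj/eqP; rewrite /mean_weight.
rewrite mulf_eq0 invr_eq0 pnatr_eq0 size_eq0 (negPf c0) orbF.
by move/eqP.
Qed.

(** The two parts of the circuit have nonpositive weights of sum 0. *)
Lemma circuit_walks A c k : visualized A -> lambda A = Fin 0%R -> critical A c ->
  forall i0, k < size c ->
  walk A k (nth i0 c 0) (nth i0 c k) 0%R /\
  walk A (size c - k) (nth i0 c k) (nth i0 c 0) 0%R.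
Proof.
move=> vA lA crit i0 kc; have le0 := path_weight_le0 (visualized_le0 vA lA).
have := circuit_weight0 lA crit; have [/andP[_ cyc] _] := crit.
case: c kc cyc {crit} => // i c kc /= cyc w0.
have lk : last i (take k c) = nth i0 (i :: c) k.
  case: k kc => [|q] kc; first by rewrite take0.
  by rewrite (last_nth i0) size_take_min (minn_idPl _) //= nth_take.
move: cyc w0; rewrite -{1 2}(cat_take_drop k c) rcons_cat cat_path path_weight_cat lk.
move=> /andP[p1 p2] w0.
have e1 : path_weight A i (take k c) = 0%R.
  by have := le0 _ _ p1; have := le0 _ _ p2; move: w0; lra.
have e2 : path_weight A (nth i0 (i :: c) k) (rcons (drop k c) i) = 0%R.
  by rewrite e1 add0r in w0.
split; first by exists (take k c); rewrite size_take_min (minn_idPl _).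
by exists (rcons (drop k c) i); rewrite last_rcons size_rcons size_drop e2 subSn.
Qed.

End Paths.

(** * The layered graph *)

Section Layers.
Context {R : realType} {n : nat}.
Variables (A : 'M[Rmax R]_n) (arcs : seq ('I_n * 'I_n)) (l step : nat).
Hypothesis arcsA : lists_arcs A arcs.
Hypothesis l0 : 0 < l.
Hypothesis step_coprime : coprime l step.
Implicit Types (i j : 'I_n) (u v e q : nat) (w : R).

Definition arc_tail e : nat := nth 0 [seq val x.1 | x <- arcs] e.
Definition arc_head e : nat := nth 0 [seq val x.2 | x <- arcs] e.
Definition arc_cost e : R := nth 0%R [seq arc_weight A x.1 x.2 | x <- arcs] e.

(** In reversed order, as the program inserts every arc at the front of a
    list. *)
Definition out_arcs u : seq nat :=
  rev [seq e <- iota 0 (size arcs) | arc_tail e == u %% n].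

(** The pair of the node [j] and the layer [r] has the number [r * n + j]. *)
Definition layer_head u e : nat := ((u %/ n + step) %% l) * n + arc_head e.

Lemma arc_nth e : e < size arcs ->
  exists i j, [/\ (i, j) \in arcs, arc_tail e = i, arc_head e = j &
                  arc_cost e = arc_weight A i j].
Proof.
move=> es; have [a _] : exists a, a \in arcs.
  by case E: arcs es => [//|a s] _; exists a; rewrite inE eqxx.
exists (nth a arcs e).1, (nth a arcs e).2.
rewrite -surjective_pairing mem_nth //.
by rewrite /arc_tail /arc_head /arc_cost; split=> //; rewrite (nth_map a).
Qed.

Lemma mem_out_arcs u e : (e \in out_arcs u) = (e < size arcs) && (arc_tail e == u %% n).
Proof. by rewrite mem_rev mem_filter mem_iota andbC. Qed.

Lemma layer_headN u e : e \in out_arcs u -> layer_head u e < n * l.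
Proof.
rewrite mem_out_arcs => /andP[/arc_nth[i [j [_ _ ej _]]] _].
rewrite /layer_head ej; have := ltn_pmod (u %/ n + step) l0.
have := ltn_ord j; move: (_ %% _) => r; clear; nia.
Qed.

Variable i0 : 'I_n.
Local Notation reach := (reach out_arcs layer_head arc_cost i0).

Lemma reach_walk v w : reach v w -> exists q j,
  [/\ walk A q i0 j w, v %% n = j & v %/ n = (q * step) %% l].
Proof.
have n0 : 0 < n := leq_ltn_trans (leq0n _) (ltn_ord i0).
elim=> [|u w' e _ [q [k [wk ek er]]]].
  exists 0, i0; rewrite modn_small // divn_small // mul0n mod0n.
  by split=> //; exact: walk0.
rewrite mem_out_arcs => /andP[/arc_nth[i [j [ija ei ej ->]]]].
rewrite ei ek => /eqP/val_inj eik; rewrite eik in ija *.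
exists (q + 1), j; split.
- by apply: walk_cat wk _; apply: walk1; rewrite -arcsA.2.
- by rewrite /layer_head ej modnMDl modn_small.
- by rewrite /layer_head ej divnMDl // [j %/ n]divn_small // addn0 er modnDml mulnDl mul1n.
Qed.

Lemma walk_reach q j w : walk A q i0 j w -> reach (((q * step) %% l) * n + j) w.
Proof.
have n0 : 0 < n := leq_ltn_trans (leq0n _) (ltn_ord i0).
elim: q j w => [|q IH] j w.
  move=> [p [_ lp /size0nil sp ->]]; rewrite sp /= in lp *.
  by rewrite -lp mul0n mod0n mul0n; exact: reach_src.
move=> /walk_rcons[k [w' [/IH re a ->]]].
have kja : (k, j) \in arcs by rewrite arcsA.2.
have es : index (k, j) arcs < size arcs by rewrite index_mem.
set e := index (k, j) arcs in es.
have [ek ej ec] : [/\ arc_tail e = k, arc_head e = j & arc_cost e = arc_weight A k j].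
  by rewrite /arc_tail /arc_head /arc_cost !(nth_map (k, j)) // nth_index.
have eu : e \in out_arcs (((q * step) %% l) * n + k).
  by rewrite mem_out_arcs es modnMDl modn_small //= ek.
have := reach_arc re eu.
rewrite ec /layer_head ej divnMDl // [k %/ n]divn_small // addn0 modnDml.
by rewrite -mulSnr.
Qed.

(** The nodes of a circuit of weight zero reach each other at no cost, so the
    paths from any of them are those from the first one, up to a shift of the
    layers. *)
Lemma path_weights_reach ck k q q' : k < l ->
  walk A q i0 ck 0%R -> walk A q' ck i0 0%R ->
  l %| q + q' -> (q * step) %% l = k -> 
  forall j w, path_weights_mod A l ck j w <-> reach (k * n + j) w.
Proof.
move=> kl w1 w2 dq qk j w; have n0 : 0 < n := leq_ltn_trans (leq0n _) (ltn_ord i0).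
split=> [/path_weights_modE[r /dvdnP[x ->] wr]|].
  have := walk_reach (walk_cat w1 wr).
  by rewrite add0r [(_ + _) * step]mulnDl [q * step + _]addnC [x * l * _]mulnAC modnMDl qk.
move=> /reach_walk[r [j' [wr]]].
rewrite modnMDl modn_small // divnMDl // divn_small // addn0 => /val_inj ej ek.
rewrite -{}ej in wr.
apply/path_weights_modE; exists (q' + r); last first.
  by have := walk_cat w2 wr; rewrite add0r.
(* the layer k determines the length modulo l because step is invertible *)
rewrite -(Gauss_dvdl _ step_coprime) mulnDl /dvdn -modnDmr -ek -qk modnDmr.
by rewrite -mulnDl -/(dvdn _ _) addnC dvdn_mulr.
Qed.

End Layers.

(** * The program *)

Notation arg_n := (IGet 0 (INum 0)).
Notation arg_m := (IGet 0 (INum 1)).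
Notation arg_l := (IGet 0 (INum 2)).

Definition for_loop (i : nat) (bound : iexp) (body : cmd) : cmd :=
  setv i (INum 0) ;; While (BNot (BLeI bound (var i))) (body ;; incr i).

Definition size_body : cmd := setv vSIZE (IAdd arg_n (var vSIZE)).

Definition layer_body : cmd :=
  If (BLeI arg_n (var vI))
     (ISet LAYER (var vI) (IAdd (IGet LAYER (ISub (var vI) arg_n)) arg_n)) Skip.

Definition clear_body : cmd := ISet ARCS (var vI) (INum 0).

(** For the columns, the arrays of the tails and of the heads are exchanged and
    layers are traversed downwards. *)
Definition tails (fwd : bool) : nat := if fwd then 1 else 2.
Definition heads (fwd : bool) : nat := if fwd then 2 else 1.

Definition list_body (fwd : bool) : cmd :=
  ISet ARC_HEAD (var vI) (IGet (heads fwd) (var vI)) ;;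
  ISet ARC_NEXT (var vI) (IGet ARCS (IGet (tails fwd) (var vI))) ;;
  ISet ARCS (IGet (tails fwd) (var vI)) (IAdd (INum 1) (var vI)).

Definition next_layer_body (fwd : bool) : cmd :=
  if fwd then
    If (BLeI (var vSIZE) (IAdd (IGet LAYER (var vI)) arg_n))
       (ISet NEXT_LAYER (var vI) (INum 0))
       (ISet NEXT_LAYER (var vI) (IAdd (IGet LAYER (var vI)) arg_n))
  else
    If (iszero (IGet LAYER (var vI)))
       (ISet NEXT_LAYER (var vI) (ISub (var vSIZE) arg_n))
       (ISet NEXT_LAYER (var vI) (ISub (IGet LAYER (var vI)) arg_n)).

Definition source_code : cmd :=
  ISet REACHED (IGet 3 (INum 0)) (INum 1) ;;
  RSet KEY (IGet 3 (INum 0)) (RNum 0) ;;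
  ISet STACK (var TOP) (IGet 3 (INum 0)) ;; incr TOP.

Definition flags (fwd : bool) : nat := if fwd then 4 else 5.
Definition values (fwd : bool) : nat := if fwd then 1 else 2.

Definition copy_body (fwd : bool) : cmd :=
  ISet (flags fwd) (var vI) (IGet REACHED (var vI)) ;;
  RSet (values fwd) (var vI) (RGet KEY (var vI)) ;;
  ISet REACHED (var vI) (INum 0).

(** The results are copied to the output and REACHED is cleared, so that the
    second search starts as the first one did. *)
Definition one_way (fwd : bool) : cmd :=
  for_loop vI arg_n clear_body ;;
  for_loop vI arg_m (list_body fwd) ;;
  for_loop vI (var vSIZE) (next_layer_body fwd) ;;
  source_code ;;
  search ;;
  for_loop vI (var vSIZE) (copy_body fwd).

Definition prepare : cmd :=
  for_loop vI arg_l size_body ;; for_loop vI (var vSIZE) layer_body.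

Definition row_col_program : cmd := prepare ;; one_way true ;; one_way false.

Section Main.
Context {R : realType}.
Implicit Types (s : memory R).

Lemma wp_for c i bound body k (P : nat -> memory R -> Prop) T T0 s :
  straight body -> (bcost (BNot (BLeI bound (var i)))).+1 + ctime (body ;; incr i) <= c ->
  c * k.+2 + T0 <= T ->
  (forall s', s' = den (setv i (INum 0)) s -> P 0 s') ->
  (forall j s, P j s -> ieval s bound = k) ->
  (forall j s, j < k -> P j s -> ints s i 0 = j ->
     P j.+1 (den (body ;; incr i) s) /\ ints (den body s) i 0 = j) ->
  wp (for_loop i bound body) T s (fun T' s' => P k s' /\ T0 <= T').
Proof.
move=> sb lec leT P0 Pk step.
have c1 : ctime (setv i (INum 0)) <= c by move: lec; rewrite /=; lia.
apply: wp_seq; apply: (wp_straight_le (c := c)) => //.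
  by move: leT; rewrite !mulnS; lia.
move=> T1 leT1.
apply: (wp_while_straight (c := c) (I := fun T s => exists j,
   [/\ ints s i 0 = j, j <= k, P j s & c * (k - j).+1 + T0 <= T])) => //.
- by rewrite /= sb.
- exists 0; split=> //; first by rewrite /= /update !eqxx.
    exact: P0.
  by move: leT; rewrite subn0 mulnS; lia.
- move=> {s T leT leT1 P0}T {}s [j [sj jk Pj leT]].
  rewrite [beval _ _]/= sj (Pk _ _ Pj) -ltnNge => ltjk.
  move: leT; rewrite mulnS -addnA => leT; split=> [|T' leT'].
    exact: leq_trans (leq_addr _ _) leT.
  have [Pj' sj'] := step _ _ ltjk Pj sj.
  exists j.+1; split=> //.
    by rewrite den_seq /= /update !eqxx sj'.
  by move: leT; rewrite subnSK //; lia.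
- move=> {s T leT leT1 P0}T {}s [j [sj jk Pj leT]].
  rewrite [beval _ _]/= sj (Pk _ _ Pj) negbK => lekj.
  have ejk : j = k by apply/eqP; rewrite eqn_leq jk.
  rewrite ejk subnn muln1 in leT Pj.
  by split=> [|T' leT']; [lia | split=> //; lia].
Qed.

Lemma for_costs fwd :
  let cost bound body :=
    (bcost (BNot (BLeI bound (var vI)))).+1 + ctime (body ;; incr vI) in
  [/\ cost arg_l size_body <= unit_cost, cost (var vSIZE) layer_body <= unit_cost,
      cost arg_n clear_body <= unit_cost & cost arg_m (list_body fwd) <= unit_cost] /\
  [/\ cost (var vSIZE) (next_layer_body fwd) <= unit_cost, ctime source_code <= unit_cost &
      cost (var vSIZE) (copy_body fwd) <= unit_cost].
Proof.
by case: fwd; split; split; apply: leq_trans (svalP unit_cost_subproof); vm_compute.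
Qed.

Lemma frame_heap p s s' : same_outside p s s' ->
  all (fun a => a \notin iwrites p) [:: TOP; STACK; TABLE; MAX_DEGREE; PARENT; MARK; DEGREE; KIDS; CELL_KID; CELL_NEXT; FRESH] ->
  heap_of s' = heap_of s.
Proof.
move=> fr /allP out.
have E a : a \in [:: TOP; STACK; TABLE; MAX_DEGREE; PARENT; MARK; DEGREE; KIDS; CELL_KID; CELL_NEXT; FRESH] ->
    ints s' a = ints s a by move=> /out; apply: frame_ints.
by rewrite /heap_of !E.
Qed.

(** In an empty heap no node has a parent, so there is no order of keys to be
    satisfied. *)
Lemma heap_ok_idle N (key key' : nat -> R) h f K :
  heap_ok N N xpred0 key h f K -> heap_ok N N xpred0 key' h f K.
Proof.
case=> [[i1 i2 i3 i4 i5 i6 i7 i8 i9 i10 i11] m1 mx]; split=> //; split=> //.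
by move=> y x yN /(i2 _ _ yN)[].
Qed.

Section OneWay.
Variables (n l : nat) (fwd : bool) (A : 'M[Rmax R]_n)
  (arcs : seq ('I_n * 'I_n)) (i0 : 'I_n).
Hypothesis l0 : 0 < l.
Hypothesis arcs_le0 : forall i j, (i, j) \in arcs -> (arc_weight A i j <= 0)%R.
Let N := n * l.
Let n0 : 0 < n := leq_ltn_trans (leq0n _) (ltn_ord i0).

(** Backwards, adding [l.-1] modulo [l] is the same as subtracting 1, and it
    makes sense for natural numbers. *)
Definition step : nat := if fwd then 1 else l.-1.

Record input_ok s : Prop := InputOk {
  in_n : ints s 0 0 = n;
  in_m : ints s 0 1 = size arcs;
  in_l : ints s 0 2 = l;
  in_tail : forall e, ints s (tails fwd) e = arc_tail arcs e;
  in_head : forall e, ints s (heads fwd) e = arc_head arcs e;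
  in_cost : forall e, reals s 0 e = arc_cost A arcs e;
  in_src : ints s 3 0 = i0
}.

Definition layers_ok s : Prop :=
  ints s vSIZE 0 = N /\ forall u, u < N -> ints s LAYER u = u %/ n * n.

Lemma input_ok_frame p s s' : same_outside p s s' ->
  all (fun a => a \notin iwrites p) [:: 0; 1; 2; 3] -> 0 \notin rwrites p ->
  input_ok s -> input_ok s'.
Proof.
move=> fr /allP out r0 [h1 h2 h3 h4 h5 h6 h7].
have E a : a \in [:: 0; 1; 2; 3] -> ints s' a = ints s a.
  by move=> /out; apply: frame_ints.
by split; rewrite ?(frame_reals fr r0) ?E //; case: (fwd).
Qed.

Lemma layers_ok_frame p s s' : same_outside p s s' ->
  vSIZE \notin iwrites p -> LAYER \notin iwrites p -> layers_ok s -> layers_ok s'.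
Proof.
by move=> fr n1 n2; rewrite /layers_ok !(frame_ints fr).
Qed.

Lemma clear_spec s T T0 : input_ok s -> unit_cost * n.+2 + T0 <= T ->
  wp (for_loop vI arg_n clear_body) T s (fun T' s' =>
    (forall i, i < n -> ints s' ARCS i = 0) /\ T0 <= T').
Proof.
move=> ok leT; have [[_ _ c _] _] := for_costs fwd.
apply: wp_mono (wp_for (P := fun j s => ints s 0 0 = n /\
  forall i, i < j -> ints s ARCS i = 0) _ c leT _ _ _) _ => //.
- by move=> _ ->; split=> //; exact: (in_n ok).
- by move=> j s' [].
- move=> j s' jn [nE hd0] sj; split=> //; split=> // i.
  rewrite ltnS leq_eqVlt /= /update /= sj; case: eqP => //= _; exact: hd0.
- by move=> T' s' [[]].
Qed.

Lemma list_spec s T T0 : input_ok s -> (forall i, i < n -> ints s ARCS i = 0) ->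
  unit_cost * (size arcs).+2 + T0 <= T ->
  wp (for_loop vI arg_m (list_body fwd)) T s (fun T' s' =>
    [/\ forall u, chain (ints s' ARC_NEXT) (ints s' ARCS (u %% n)) (out_arcs arcs u),
        forall e, e < size arcs -> ints s' ARC_HEAD e = arc_head arcs e &
        T0 <= T']).
Proof.
move=> ok hd0 leT; have [[_ _ _ c] _] := for_costs fwd.
apply: wp_mono (wp_for (P := fun j s => [/\ input_ok s,
  forall i, i < n -> chain (ints s ARC_NEXT) (ints s ARCS i)
     (rev [seq e <- iota 0 j | arc_tail arcs e == i]) &
  forall e, e < j -> ints s ARC_HEAD e = arc_head arcs e]) _ c leT _ _ _) _ => //.
- by move=> _ ->; split=> [|i /hd0|//]; first exact: input_ok_frame (den_frame (p := setv vI (INum 0)) s isT) isT isT ok.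
- by move=> j s' [/in_m].
- move=> j s' jm [ok' ch tg] sj.
  set s1 := den (list_body fwd) s'.
  have -> : den (list_body fwd ;; incr vI) s' = den (incr vI) s1 by [].
  have sj1 : ints s1 vI 0 = j by rewrite -sj.
  split=> //.
  have hd1 : ints s1 ARCS = upd (ints s' ARCS) (arc_tail arcs j) j.+1.
    by rewrite -(in_tail ok') -sj /s1; case: (fwd).
  have nx1 : ints s1 ARC_NEXT = upd (ints s' ARC_NEXT) j (ints s' ARCS (arc_tail arcs j)).
    by rewrite -(in_tail ok') -sj /s1; case: (fwd).
  have tg1 : ints s1 ARC_HEAD = upd (ints s' ARC_HEAD) j (arc_head arcs j).
    by rewrite -(in_head ok') -sj /s1; case: (fwd).
  split.
  + exact: input_ok_frame (den_frame (p := list_body fwd ;; incr vI) s' isT) isT isT ok'.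
  + move=> i iN; rewrite -[ints _ ARC_NEXT]/(ints s1 ARC_NEXT) -[ints _ ARCS]/(ints s1 ARCS) hd1 nx1.
    rewrite -[in iota 0 _]addn1 iotaD filter_cat /= add0n.
    have chi : chain (upd (ints s' ARC_NEXT) j (ints s' ARCS (arc_tail arcs j)))
       (ints s' ARCS i) (rev [seq e <- iota 0 j | arc_tail arcs e == i]).
      apply: chain_ext (ch i iN) => e; rewrite mem_rev mem_filter mem_iota /= add0n.
      by case/andP=> _ ej; rewrite upd_other // neq_ltn ej.
    have [ei|ni] := eqVneq (arc_tail arcs j) i; last first.
      by rewrite cats0 upd_other // eq_sym.
    rewrite cats1 rev_rcons -ei upd_same /= upd_same; split=> //.
    by move: chi; rewrite -ei.
  + move=> e; rewrite -[ints _ ARC_HEAD]/(ints s1 ARC_HEAD) tg1 ltnS leq_eqVlt /upd.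
    by case: eqP => [->|_] //; apply: tg.
- move=> T' s' [[_ ch tg] le]; split=> // u.
  by apply: ch; rewrite ltn_mod.
Qed.

Lemma next_layer_spec s T T0 : input_ok s -> layers_ok s ->
  unit_cost * N.+2 + T0 <= T ->
  wp (for_loop vI (var vSIZE) (next_layer_body fwd)) T s (fun T' s' =>
    (forall u, u < N -> ints s' NEXT_LAYER u = ((u %/ n + step) %% l) * n) /\ T0 <= T').
Proof.
move=> ok ly leT; have [_ [c _ _]] := for_costs fwd.
apply: wp_mono (wp_for (P := fun j s => [/\ ints s 0 0 = n, layers_ok s &
  forall u, u < j -> ints s NEXT_LAYER u = ((u %/ n + step) %% l) * n]) _ c leT _ _ _) _ => //.
- by case: (fwd).
- by move=> _ ->; split=> //; exact: (in_n ok).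
- by move=> j s' [_ []].
- move=> j s' jN [nE [NE lE] nb] sj.
  set s1 := den (next_layer_body fwd) s'.
  have -> : den (next_layer_body fwd ;; incr vI) s' = den (incr vI) s1 by [].
  have jl : j %/ n < l by rewrite ltn_divLR // mulnC.
  have E : ints s1 NEXT_LAYER = upd (ints s' NEXT_LAYER) j (((j %/ n + step) %% l) * n) /\
      forall a, a != NEXT_LAYER -> ints s1 a = ints s' a.
    rewrite /s1 /step /next_layer_body; case: (fwd).
      rewrite den_if [beval _ _]/= NE nE sj lE //.
      have [lt|ge] := leqP N (j %/ n * n + n).
        have -> : (j %/ n + 1) %% l = 0.
          have -> : j %/ n + 1 = l; last by rewrite modnn.
          have : l <= j %/ n + 1.
            by rewrite -(leq_pmul2r n0) mulnDl mul1n [l * n]mulnC.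
          lia.
        by split=> [|a /negPf na]; [rewrite -sj | rewrite /= /update na].
      rewrite modn_small; last first.
        by rewrite -(ltn_pmul2r n0) mulnDl mul1n [l * n]mulnC.
      rewrite mulnDl mul1n; split=> [|a /negPf na]; last by rewrite /= /update na.
      by rewrite -lE // -sj -nE.
    rewrite den_if [beval _ _]/= leqn0 sj lE //.
    case: eqP => [e0|/eqP ne].
      have j0 : j %/ n = 0 by move/eqP: e0; rewrite muln_eq0 (gtn_eqF n0) orbF => /eqP.
      rewrite j0 add0n modn_small ?prednK // -subn1 mulnBl mul1n mulnC -/N.
      by split=> [|a /negPf na]; [rewrite -nE -NE -sj | rewrite /= /update na].
    have [x ex] : exists x, j %/ n = x.+1.
      by move: ne; case: (j %/ n) => [|x]; rewrite ?mul0n // => _; exists x.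
    have -> : (j %/ n + l.-1) %% l = x.
      rewrite ex addSnnS prednK // modnDr modn_small //; lia.
    split=> [|a /negPf na]; last by rewrite /= /update na.
    have -> : x * n = j %/ n * n - n by rewrite ex mulSn addKn.
    by rewrite -lE // -nE -sj.
  case: E => nb1 E.
  split; last by rewrite E.
  split.
  + by rewrite -[ints _ 0]/(ints s1 0) E.
  + split; first by rewrite -[ints _ vSIZE]/(ints s1 vSIZE) E.
    by move=> u; rewrite -[ints _ LAYER]/(ints s1 LAYER) E //; apply: lE.
  + move=> u; rewrite -[ints _ NEXT_LAYER]/(ints s1 NEXT_LAYER) nb1 ltnS leq_eqVlt /upd.
    by case: eqP => [->|_] //; apply: nb.
- by move=> T' s' [[]].
Qed.

Lemma copy_spec s T T0 : ints s vSIZE 0 = N -> unit_cost * N.+2 + T0 <= T ->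
  wp (for_loop vI (var vSIZE) (copy_body fwd)) T s (fun T' s' =>
    [/\ forall u, u < N -> ints s' (flags fwd) u = ints s REACHED u,
        forall u, u < N -> reals s' (values fwd) u = reals s KEY u,
        forall u, u < N -> ints s' REACHED u = 0 & T0 <= T']).
Proof.
move=> NE leT; have [_ [_ _ c]] := for_costs fwd.
have copies s1 j : ints s1 vI 0 = j ->
    [/\ ints (den (copy_body fwd) s1) (flags fwd) =
          upd (ints s1 (flags fwd)) j (ints s1 REACHED j),
        reals (den (copy_body fwd) s1) (values fwd) =
          upd (reals s1 (values fwd)) j (reals s1 KEY j),
        ints (den (copy_body fwd) s1) REACHED = upd (ints s1 REACHED) j 0,
        reals (den (copy_body fwd) s1) KEY = reals s1 KEY &
        ints (den (copy_body fwd) s1) vSIZE = ints s1 vSIZE /\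
        ints (den (copy_body fwd) s1) vI = ints s1 vI].
  by move=> <-; case: (fwd).
apply: wp_mono (wp_for (P := fun j s1 => [/\ ints s1 vSIZE 0 = N,
  reals s1 KEY = reals s KEY,
  forall u, j <= u -> ints s1 REACHED u = ints s REACHED u &
  forall u, u < j -> [/\ ints s1 (flags fwd) u = ints s REACHED u,
    reals s1 (values fwd) u = reals s KEY u & ints s1 REACHED u = 0]])
  _ c leT _ _ _) _ => //.
- by move=> _ ->.
- by move=> j s' [].
- move=> j s' jN [NE' kE fE cE] sj.
  have [c1 c2 c3 c4 [c5 c6]] := copies s' j sj.
  move: c1 c2 c3 c4 c5 c6; rewrite den_seq.
  set s1 := den (copy_body fwd) s' => c1 c2 c3 c4 c5 c6.
  split; last by rewrite c6.
  have eI : forall a, a != vI -> ints (den (incr vI) s1) a = ints s1 a.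
    by move=> a /negPf na; rewrite /= /update na.
  have eR : reals (den (incr vI) s1) = reals s1 by [].
  rewrite eR !eI //; last by case: (fwd).
  rewrite c1 c2 c3 c4 c5; split=> //.
  + by move=> u ju; rewrite upd_other ?fE //; [exact: ltnW | rewrite neq_ltn ju orbT].
  + move=> u; rewrite ltnS leq_eqVlt => /predU1P[->|uj].
      by rewrite !upd_same kE fE.
    by rewrite !upd_other ?neq_ltn ?uj //; apply: cE.
- move=> T' s' [[_ _ _ cE] le].
  by split=> // u /cE[].
Qed.

Local Notation G := (out_arcs arcs).
Local Notation tgt := (layer_head (n := n) arcs l step).
Local Notation reach := (reach G tgt (arc_cost A arcs) i0).

Definition way_cost : nat :=
  unit_cost * (n.+2 + (size arcs).+2 + N.+2 + N.+2 + 5) +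
  search_credit N G xpred0.

Definition way_ok s f K : Prop :=
  [/\ heap_ok N N xpred0 (reals s KEY) (heap_of s) f K,
      forall d, tab (heap_of s) d = 0, layers_ok s, input_ok s &
      forall u, u < N -> ints s REACHED u = 0].

Lemma source_spec s s' f K : s' = den source_code s -> way_ok s f K ->
  [/\ heap_ok N N (active N (ints s' REACHED) xpred0) (reals s' KEY) (heap_of s') f K,
      heap_of s' = push (heap_of s) i0 &
      dij N G tgt (arc_cost A arcs) i0 (ints s' REACHED) (reals s' KEY) xpred0 N [::]].
Proof.
have i0N : i0 < N by apply: (leq_trans (ltn_ord i0)); apply: leq_pmulr.
move=> es [ok t0 ly io f0].
have fs' : ints s' REACHED = upd (ints s REACHED) i0 1 by rewrite es -(in_src io).
have ks' : reals s' KEY = upd (reals s KEY) i0 0%R by rewrite es -(in_src io).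
have hs' : heap_of s' = push (heap_of s) i0 by rewrite es -(in_src io).
rewrite fs' ks' hs'; split=> //.
- apply: (@heap_ok_eq _ _ _ (fun x => false || (x == i0))).
    move=> x; rewrite /active /upd /= andbT; case: eqP => [->|_]; first by rewrite i0N.
    by case: (ltnP x N) => //= xN; rewrite f0.
  case: (heap_ok_idle (upd (reals s KEY) i0 0%R) ok) => I m1 mx.
  by split=> //; apply: inv_push.
- split=> //; first last.
    by rewrite !upd_same.
  move=> v vN; rewrite /upd; case: (v =P i0 :> nat) => [->|_]; last by rewrite f0.
  by move=> _; exact: reach_src.
Qed.

(** The potential of the heap at the start may be positive: entries of lists
    could remain from an earlier search. *)
Lemma one_way_spec s f K T T0 : way_ok s f K ->
  potential N (heap_of s) K + way_cost + T0 <= T ->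
  wp (one_way fwd) T s (fun T' s' => exists f' K',
    [/\ way_ok s' f' K', potential N (heap_of s') K' + T0 <= T' &
       forall v, v < N ->
          (ints s' (flags fwd) v != 0 -> reach v (reals s' (values fwd) v)) /\
          (forall w, reach v w -> ints s' (flags fwd) v != 0 /\
                                  (w <= reals s' (values fwd) v)%R)]).
Proof.
have i0N : i0 < N by apply: (leq_trans (ltn_ord i0)); apply: leq_pmulr.
have srcu := proj2 (for_costs true); have {srcu} c1 : ctime source_code <= unit_cost by case: srcu.
rewrite /way_cost; set CR := search_credit _ _ _.
rewrite !mulnDr => wok leT.
have [ok t0 ly io f0] := wok.
apply: wp_seq.
have le1 : unit_cost * n.+2 + (potential N (heap_of s) K + CR + unit_cost * (size arcs).+2
   + unit_cost * N.+2 + unit_cost * N.+2 + unit_cost * 5 + T0) <= T by lia.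
apply: wp_mono (wp_frame (clear_spec io le1)) _ => T1 s1 [[hd1 {}le1] fr1].
have hs1 := frame_heap fr1 isT; have io1 := input_ok_frame fr1 isT isT io.
have ly1 := layers_ok_frame fr1 isT isT ly; have fl1 := frame_ints (a := REACHED) fr1 isT.
have ks1 := frame_reals (a := KEY) fr1 isT.
rewrite -hs1 -ks1 in ok t0 le1; rewrite -fl1 in f0.
clear wok leT io ly fr1 hs1 fl1 ks1 s T.
apply: wp_seq.
have le2 : unit_cost * (size arcs).+2 + (potential N (heap_of s1) K + CR
   + unit_cost * N.+2 + unit_cost * N.+2 + unit_cost * 5 + T0) <= T1 by lia.
apply: wp_mono (wp_frame (list_spec io1 hd1 le2)) _ => T2 s2 [[ch tg {}le2] fr2].
have hs2 := frame_heap fr2 isT; have io2 := input_ok_frame fr2 isT isT io1.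
have ly2 := layers_ok_frame fr2 isT isT ly1; have fl2 := frame_ints (a := REACHED) fr2 isT.
have ks2 := frame_reals (a := KEY) fr2 isT.
rewrite -hs2 -ks2 in ok t0 le2; rewrite -fl2 in f0.
clear le1 hd1 io1 ly1 fr2 hs2 fl2 ks2 s1 T1.
apply: wp_seq.
have le3 : unit_cost * N.+2 + (potential N (heap_of s2) K + CR
    + unit_cost * N.+2 + unit_cost * 5 + T0) <= T2 by lia.
apply: wp_mono (wp_frame (next_layer_spec io2 ly2 le3)) _ => T3 s3 [[nb {}le3] fr3].
have [w3 w3'] : iwrites (for_loop vI (var vSIZE) (next_layer_body fwd)) = [:: vI; NEXT_LAYER; NEXT_LAYER; vI]
    /\ rwrites (for_loop vI (var vSIZE) (next_layer_body fwd)) = [::].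
  by case: (fwd).
have hs3 : heap_of s3 = heap_of s2 by apply: frame_heap fr3 _; rewrite w3.
have io3 : input_ok s3 by apply: input_ok_frame fr3 _ _ io2; rewrite ?w3 ?w3'.
have ly3 : layers_ok s3 by apply: layers_ok_frame fr3 _ _ ly2; rewrite w3.
have fl3 : ints s3 REACHED = ints s2 REACHED by apply: frame_ints fr3 _; rewrite w3.
have ks3 : reals s3 KEY = reals s2 KEY by apply: frame_reals fr3 _; rewrite w3'.
have nx3 : ints s3 ARC_NEXT = ints s2 ARC_NEXT by apply: frame_ints fr3 _; rewrite w3.
have hd3 : ints s3 ARCS = ints s2 ARCS by apply: frame_ints fr3 _; rewrite w3.
have tg3 : ints s3 ARC_HEAD = ints s2 ARC_HEAD by apply: frame_ints fr3 _; rewrite w3.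
rewrite -hs3 -ks3 in ok t0 le3; rewrite -fl3 in f0; rewrite -nx3 -hd3 in ch.
rewrite -tg3 in tg.
have gs3 : graph_in N G tgt (arc_cost A arcs) s3.
  move=> u uN; have [_ lb] := ly3.
  rewrite lb // {1}(divn_eq u n) addKn; split=> // e.
  rewrite /layer_head nb // mem_out_arcs => /andP[em _].
  by rewrite tg // addnC (in_cost io3).
clear le2 ch tg nb fr3 io2 ly2 hs3 fl3 ks3 w3 w3' nx3 hd3 tg3 s2 T2.
apply: wp_seq; apply: (wp_straight_le _ c1) => //; first by lia.
move=> T4 leT4.
have [ok4 hs4 ds4] := source_spec (erefl (den source_code s3))
  (And5 ok t0 ly3 io3 f0).
have gs4 : graph_in N G tgt (arc_cost A arcs) (den source_code s3) by [].
have io4 : input_ok (den source_code s3).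
  exact: input_ok_frame (den_frame (p := source_code) _ isT) isT isT io3.
have ly4 : layers_ok (den source_code s3) by [].
move: (den source_code s3) ok4 hs4 ds4 gs4 io4 ly4 => s4 ok4 hs4 ds4 gs4 io4 ly4.
have t4 d : tab (heap_of s4) d = 0 by rewrite hs4; exact: t0.
have le4 : potential N (heap_of s4) K + CR + unit_cost + (unit_cost * N.+2 + T0) <= T4.
  by rewrite hs4 potential_push; lia.
clear leT4 le3 gs3 io3 ly3 ok t0 f0 hs4 s3 T3.
have tgtN u e : u < N -> e \in G u -> tgt u e < N by move=> _; exact: (layer_headN A).
have wt0 u e : u < N -> e \in G u -> (arc_cost A arcs e <= 0)%R.
  move=> _; rewrite mem_out_arcs => /andP[em _].
  by have [i [j [ija _ _ ->]]] := arc_nth A em; exact: arcs_le0.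
apply: wp_seq.
have H := search_spec i0N tgtN wt0 gs4 ok4 t4 ds4 le4.
apply: wp_mono (wp_frame H) _ => T5 s5 [[f5 [K5 [ok5 t5 le5 res5]]] fr5].
have io5 := input_ok_frame fr5 isT isT io4.
have ly5 := layers_ok_frame fr5 isT isT ly4.
clear ok4 ds4 gs4 t4 le4 H fr5 io4 ly4 s4 T4.
have {}le5 : unit_cost * N.+2 + (potential N (heap_of s5) K5 + T0) <= T5 by lia.
apply: wp_mono (wp_frame (copy_spec (proj1 ly5) le5)) _.
move=> T6 s6 [[fE kE f6 le6] fr6].
have [w6 w6'] : iwrites (for_loop vI (var vSIZE) (copy_body fwd)) = [:: vI; flags fwd; REACHED; vI]
    /\ rwrites (for_loop vI (var vSIZE) (copy_body fwd)) = [:: values fwd].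
  by case: (fwd).
have hs6 : heap_of s6 = heap_of s5.
  by apply: frame_heap fr6 _; rewrite w6; case: (fwd).
exists f5, K5; rewrite hs6; split=> //.
- split=> //.
  + by rewrite hs6; exact: heap_ok_idle ok5.
  + by rewrite hs6.
  + by apply: layers_ok_frame fr6 _ _ ly5; rewrite w6; case: (fwd).
  + by apply: input_ok_frame fr6 _ _ io5; rewrite ?w6 ?w6'; case: (fwd).
- by move=> v vN; rewrite fE // kE //; exact: res5.
Qed.

End OneWay.
End Main.

(** * Initial state and final bounds *)

Section Start.
Context {R : realType}.
Implicit Types (s : memory R).

Lemma prepare_spec n l s T T0 : 0 < n -> ints s 0 0 = n -> ints s 0 2 = l ->
  ints s vSIZE 0 = 0 -> (forall u, ints s LAYER u = 0) ->
  unit_cost * l.+2 + (unit_cost * (n * l).+2 + T0) <= T ->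
  wp prepare T s
    (fun T' s' => layers_ok n l s' /\ T0 <= T').
Proof.
move=> n0 nE lE N0 L0 leT; have [[c1 c2 _ _] _] := for_costs true.
apply: wp_seq.
have H1 := wp_for (s := s) (k := l) (P := fun j s1 =>
  ints s1 0 2 = l /\ (ints s1 0 0 = n /\ ints s1 vSIZE 0 = n * j)) _ c1 leT.
apply: wp_mono (wp_frame (H1 _ _ _ _)) _ => //.
- by move=> _ ->; rewrite muln0.
- by move=> j s1 [].
- move=> j s1 jl [e1 [e2 e3]] sj; split=> //; split=> //; split=> //.
  by rewrite mulnS -e3 -e2.
move=> T1 s1 [[[_ [nE1 NE1]] leT1] fr1] {H1}.
have LB1 := frame_ints (a := LAYER) fr1 isT.
have H2 := wp_for (s := s1) (k := n * l) (P := fun j s2 =>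
  [/\ ints s2 vSIZE 0 = n * l, ints s2 0 0 = n &
   forall u, ints s2 LAYER u = if u < j then u %/ n * n else 0]) _ c2 leT1.
apply: wp_mono (H2 _ _ _ _) _ => //.
- by move=> _ ->; split=> // u; rewrite -[LHS]/(ints s1 LAYER u) LB1 L0.
- by move=> j s2 [].
- move=> j s2 jN [e1 e2 e3] sj; rewrite den_seq.
  set s3 := den layer_body s2.
  have [E3 E3'] : ints s3 LAYER = upd (ints s2 LAYER) j (j %/ n * n) /\
      forall a, a != LAYER -> ints s3 a = ints s2 a.
    rewrite /s3 /layer_body den_if [beval _ _]/= e2 sj.
    case: leqP => [nj|jn]; last first.
      split=> //; apply/funext => u; rewrite /upd; case: eqP => // ->.
      by rewrite [LHS]e3 ltnn divn_small.
    split=> [|a /negPf na]; last by rewrite /= /update na.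
    have -> : j %/ n * n = ints s2 LAYER (j - n) + n.
      rewrite e3 (_ : j - n < j); last by lia.
      by rewrite -{1}(subnK nj) divnDr // divnn n0 addn1 mulSnr.
    by rewrite -e2 -sj.
  split; last by rewrite E3'.
  split; first by rewrite -[LHS]/(ints s3 vSIZE 0) E3'.
    by rewrite -[LHS]/(ints s3 0 0) E3'.
  move=> u; rewrite -[LHS]/(ints s3 LAYER u) E3 /upd; case: (u =P j) => [->|/eqP nu].
    by rewrite ltnSn.
  by rewrite e3 ltnS [u <= j]leq_eqVlt (negPf nu).
- move=> T2 s2 [[e1 _ e3] le2]; split=> //; split=> // u uN.
  by rewrite e3 uN.
Qed.

Lemma sum_indicator n (t : nat) : \sum_(i < n) (t == i) <= 1.
Proof.
have [tn|nt] := ltnP t n.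
  rewrite (bigD1 (Ordinal tn)) //= eqxx big1 // => i.
  by rewrite -val_eqE /= eq_sym => /negPf->.
rewrite big1 // => i _; case: eqP => // e.
by have := ltn_ord i; rewrite -e ltnNge nt.
Qed.

(** Each arc occurs once in each layer. *)
Lemma arcs_left_le n l (arcs : seq ('I_n * 'I_n)) :
  arcs_left (n * l) (out_arcs arcs) xpred0 <= l * size arcs.
Proof.
rewrite /arcs_left /=.
pose F i := size [seq e <- iota 0 (size arcs) | arc_tail arcs e == i].
have [n0|n0] := posnP n.
  rewrite big1 // => i _; have := ltn_ord i; move: (nat_of_ord i) => x.
  by move=> xn; have : false by move: xn; rewrite {1}n0.
have -> : \sum_(x < n * l) size (out_arcs arcs x) = l * \sum_(i < n) F i.
  elim: l => [|l IH]; first by rewrite muln0 big_ord0.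
  rewrite mulnSr big_split_ord /= IH mulSnr; congr addn.
  apply: eq_bigr => i _; rewrite size_rev mulnC modnMDl modn_small //.
rewrite leq_mul2l; apply/orP; right.
rewrite -[leqRHS](size_iota 0) /F; elim: (iota _ _) => [|e s IH].
  by rewrite big1.
rewrite (eq_bigr (fun i : 'I_n => (arc_tail arcs e == i) +
    size [seq e0 <- s | arc_tail arcs e0 == i])); last first.
  by move=> i _ /=; case: (_ == _).
rewrite big_split /= -add1n; apply: leq_add; [exact: sum_indicator | exact: IH].
Qed.

Lemma idle_start N s :
  (forall a k, 6 <= a -> ints s a k = 0) ->
  heap_ok N N xpred0 (reals s KEY) (heap_of s) (fun=> 0) (fun=> [::]) /\
  potential N (heap_of s) (fun=> [::]) = 0.
Proof.
move=> s0; split.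
  split=> //=; last by rewrite s0.
    split=> //=; rewrite /kids_of /kids_below /at_root /=.
    + by move=> y x _; rewrite s0.
    + by move=> y _ _; rewrite s0.
    + by move=> x _; rewrite s0 // big1 // => i _; rewrite s0.
    + by move=> x k _; rewrite big1 // => i _; rewrite s0.
    + by move=> x _; rewrite s0 // big_ord0 s0.
    + by move=> i; rewrite s0.
    + by move=> d x; rewrite s0.
    + by move=> x _; rewrite s0.
    + by move=> y x _; rewrite s0.
    + by move=> y _; rewrite s0.
  by move=> y _; rewrite s0.
rewrite /potential /tabs /marks /cells /= s0 // !big1 ?muln0 // => i _; by rewrite s0.
Qed.

Lemma output_is_max (S : set R) s flag value k (r : R -> Prop) :
  (forall w, S w <-> r w) ->
  (ints s flag k != 0 -> r (reals s value k)) /\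
  (forall w, r w -> ints s flag k != 0 /\ (w <= reals s value k)%R) ->
  is_max S (output_entry s flag value k).
Proof.
move=> Sr [h1 h2]; rewrite /output_entry; case: eqP => [f0|/eqP f0] /=.
  by apply/seteqP; split=> // w /Sr /h2[]; rewrite f0.
by split; [apply/Sr/h1 | move=> w /Sr /h2[]].
Qed.

Lemma size_arcs n (A : 'M[Rmax R]_n) arcs : lists_arcs A arcs ->
  size arcs = num_finite A.
Proof.
move=> [uq arcsA]; rewrite /num_finite -(card_uniqP uq); apply: eq_card => -[i j].
by rewrite arcsA; apply/idP/idP; rewrite in_setE.
Qed.

(** From [2 ^ L <= n ^ 2] and [ln 2 >= 1 / 2]. *)
Lemma log_bound n N : 1 < n -> 0 < N -> N <= n * n ->
  ((trunc_log 2 N).+1%:R <= 6 * ln n%:R :> R)%R.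
Proof.
move=> n1 N0 leN; set L := trunc_log 2 N.
have ln2 : (2^-1 <= ln 2 :> R)%R.
  have : (ln (1 + - 2^-1) <= - 2^-1 :> R)%R by apply: le_ln1Dx; lra.
  have -> : (1 + - 2^-1 = 2^-1 :> R)%R by lra.
  rewrite lnV ?posrE //; lra.
have lnn : (ln 2 <= ln n%:R :> R)%R.
  by rewrite ler_ln ?posrE ?ltr0n ?ler_nat //; lia.
have : (ln ((2 ^ L)%:R : R) <= ln ((n * n)%:R))%R.
  rewrite ler_ln ?posrE ?ltr0n ?ler_nat ?expn_gt0 ?muln_gt0 //; last by lia.
  by apply: leq_trans leN; apply: trunc_logP.
rewrite natrM lnM ?posrE ?ltr0n; [|lia|lia].
rewrite natrX lnXn ?ltr0n // -[(ln _ *+ _)%R]mulr_natl -[L.+1]addn1 natrD.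
have : (0 <= L%:R :> R)%R by [].
move: (ln 2) (ln n%:R) (L%:R)%R ln2 lnn => a b x ln2 lnn x0 le1.
have := ler_wpM2l x0 ln2. lra.
Qed.

End Start.

Lemma modn_sub_mul_pred k l : k < l -> ((l - k) * l.-1) %% l = k.
Proof.
move=> kl; rewrite -{1 2}(subnK kl); set x := l - k.+1.
have -> : x + k.+1 - k = x.+1 by lia.
have -> : x.+1 * (x + k.+1).-1 = x * (x + k.+1) + k by rewrite addnS /=; lia.
by rewrite /x subnK // modnMDl modn_small.
Qed.

Section Final.
Context {R : realType}.
Variables (n l : nat) (A : 'M[Rmax R]_n) (arcs : seq ('I_n * 'I_n))
  (c : l.-tuple 'I_n).
Hypotheses (visA : visualized A) (lamA : lambda A = Fin 0%R)
  (arcsA : lists_arcs A arcs) (critA : critical A c) (elemA : elementary_circuit A c).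

Let m := size arcs.
Let N := n * l.

Lemma length_pos : 0 < l.
Proof. by rewrite -(size_tuple c) lt0n size_eq0; case: critA => /andP[]. Qed.

Let l0 := length_pos.
Let i0 : 'I_n := tnth c (Ordinal l0).

Let n0 : 0 < n := leq_ltn_trans (leq0n _) (ltn_ord i0).

Lemma first_node x : nth x c 0 = i0.
Proof. by rewrite /i0 (tnth_nth x). Qed.

Lemma circuit_nth (k : 'I_l) : tnth c k = nth i0 c k.
Proof. exact: tnth_nth. Qed.

(** An elementary circuit does not repeat nodes; this is why the number of
    layered nodes is at most [n ^ 2]. *)
Lemma length_le : l <= n.
Proof.
have /andP[_ uc] := elemA.
by rewrite -{1}(size_tuple c) -(card_uniqP uc) -[leqRHS]card_ord max_card.
Qed.

(** For [n = 1] the logarithm vanishes, and the whole cost has to be charged to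
    the arcs. *)
Lemma arcs_pos : 0 < m.
Proof.
have : walk A (size c - 0) (nth i0 c 0) (nth i0 c 0) 0%R.
  by apply: (proj2 (circuit_walks visA lamA critA i0 _)); rewrite size_tuple.
have -> : size c - 0 = l.-1.+1 by rewrite subn0 size_tuple prednK.
move=> /walk_rcons[k [w [_ a _]]].
have : (k, nth i0 c 0) \in arcs by rewrite arcsA.2.
by rewrite /m; case: (arcs).
Qed.

Definition swap_arcs : seq ('I_n * 'I_n) := [seq (a.2, a.1) | a <- arcs].

Lemma lists_swap : lists_arcs A^T swap_arcs.
Proof.
have [uq mem] := arcsA; split.
  by rewrite map_inj_uniq // => -[i j] [i' j'] [-> ->].
move=> i j; rewrite /arc mxE -/(arc A j i) -mem.
apply/mapP/idP => [[[i' j'] ija [-> ->]]//|jia]; by exists (j, i).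
Qed.

Lemma le0_arcs i j : (i, j) \in arcs -> (arc_weight A i j <= 0)%R.
Proof. by rewrite arcsA.2; exact: visualized_le0 visA lamA _ _. Qed.

Lemma le0_swap i j : (i, j) \in swap_arcs -> (arc_weight A^T i j <= 0)%R.
Proof.
rewrite lists_swap.2 /arc /arc_weight mxE => a.
by have := visualized_le0 visA lamA (i := j) (j := i); apply.
Qed.

Let s0 := input A arcs c.

Lemma input_fwd s : (forall a, a \in [:: 0; 1; 2; 3] -> ints s a = ints s0 a) ->
  reals s 0 = reals s0 0 -> input_ok l true A arcs i0 s.
Proof.
move=> es er; split; rewrite ?es ?er //=.
  by rewrite size_tuple.
by rewrite (nth_map i0) ?size_tuple // first_node.
Qed.

Lemma input_bwd s : (forall a, a \in [:: 0; 1; 2; 3] -> ints s a = ints s0 a) ->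
  reals s 0 = reals s0 0 -> input_ok l false A^T swap_arcs i0 s.
Proof.
move=> es er; split; rewrite ?es ?er //=.
- by rewrite size_map.
- by rewrite size_tuple.
- by move=> e; rewrite /arc_tail -map_comp.
- by move=> e; rewrite /arc_head -map_comp.
- move=> e; rewrite /arc_cost -map_comp; congr nth; apply: eq_map => a /=.
  by rewrite /arc_weight mxE.
- by rewrite (nth_map i0) ?size_tuple // first_node.
Qed.

Lemma reach_rows (k : 'I_l) j w : path_weights_mod A l (tnth c k) j w <->
  reach (out_arcs arcs) (layer_head (n := n) arcs l (step l true))
     (arc_cost A arcs) i0 (k * n + j) w.
Proof.
have [w1 w2] : walk A k i0 (tnth c k) 0%R /\ walk A (l - k) (tnth c k) i0 0%R.
  have := circuit_walks visA lamA critA i0 (k := k).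
  rewrite size_tuple circuit_nth first_node; exact.
apply: (path_weights_reach (step := 1) arcsA _ (ltn_ord k) w1 w2 _ _ j w).
- exact: coprimen1.
- by rewrite subnKC // ltnW.
- by rewrite muln1 modn_small.
Qed.

(** The transposed circuit leads from [c_0] to [c_k] with [l - k] arcs, and
    [(l - k) * (l - 1)] is [k] modulo [l]. *)
Lemma reach_cols (k : 'I_l) j w : path_weights_mod A l j (tnth c k) w <->
  reach (out_arcs swap_arcs) (layer_head (n := n) swap_arcs l (step l false))
     (arc_cost A^T swap_arcs) i0 (k * n + j) w.
Proof.
have [w1 w2] : walk A k i0 (tnth c k) 0%R /\ walk A (l - k) (tnth c k) i0 0%R.
  have := circuit_walks visA lamA critA i0 (k := k).
  rewrite size_tuple circuit_nth first_node; exact.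
have := path_weights_reach lists_swap (step := l.-1) _ (ltn_ord k)
  (walk_tr w2) (walk_tr w1) _ _ j w.
move=> H; apply: iff_trans (H _ _ _).
- split=> /path_weights_modE[q dq wq]; apply/path_weights_modE; exists q => //.
    exact: walk_tr.
  exact/walk_trE.
- by rewrite coprime_sym coprimePn.
- by rewrite subnK // ltnW.
- exact: modn_sub_mul_pred.
Qed.

Definition total_time : nat := unit_cost * (100 * (N * (trunc_log 2 N).+1) + 30 * (l * m)).

Lemma way_cost_le (arcs' : seq ('I_n * 'I_n)) : size arcs' = m ->
  way_cost l arcs' <= unit_cost * (31 * N + m + 15 * (N * (trunc_log 2 N).+1) + 14 * (l * m)).
Proof.
move=> em; rewrite /way_cost /search_credit em -/N.
have := arcs_left_le l arcs'; rewrite em -/N.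
have -> : undone N xpred0 = N.
  by rewrite /undone /= sum_nat_const card_ord muln1.
rewrite /deg_bound; move: (arcs_left _ _ _) (trunc_log _ _).+1 => a L le.
have nN : n <= N by rewrite leq_pmulr.
have N0 : 0 < N by rewrite muln_gt0 n0.
rewrite -[14 * unit_cost * a]mulnA [14 * (unit_cost * a)]mulnCA -mulnA -mulnA -!mulnDr.
rewrite leq_mul2l; apply/orP; right.
rewrite mulnDl -[5 * (3 * L) * N]mulnA -mulnA [L * N]mulnC; lia.
Qed.

(** The second search starts with the credits that the first one has left in the
    heap, and it does not write to the output of the first one. *)
Lemma main_spec : exists t s,
  [/\ exec row_col_program s0 t s, t <= total_time,
      forall (k : 'I_l) (j : 'I_n),
        is_max (path_weights_mod A l (tnth c k) j) (row_output s k j) &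
      forall (k : 'I_l) (j : 'I_n),
        is_max (path_weights_mod A l j (tnth c k)) (col_output s k j)].
Proof.
have inN (k : 'I_l) (j : 'I_n) : k * n + j < N.
  have := ltn_ord k; have := ltn_ord j; rewrite /N; clear.
  move: (nat_of_ord k) (nat_of_ord j) => x y; nia.
suff : wp row_col_program total_time s0 (fun T s =>
   (forall (k : 'I_l) (j : 'I_n),
     is_max (path_weights_mod A l (tnth c k) j) (row_output s k j)) /\
   (forall (k : 'I_l) (j : 'I_n),
     is_max (path_weights_mod A l j (tnth c k)) (col_output s k j))).
  by move=> [t [T' [s [ex le [H1 H2]]]]]; exists t, s; split=> //; lia.
have [ok0 pot0] : heap_ok N N xpred0 (reals s0 KEY) (heap_of s0) (fun=> 0) (fun=> [::]) /\
    potential N (heap_of s0) (fun=> [::]) = 0.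
  by apply: idle_start => a k a6; rewrite /s0 /input /=; do 4 (case: a a6 => // a a6).
have leT : unit_cost * l.+2 + (unit_cost * N.+2 + (way_cost l arcs + way_cost l swap_arcs))
    <= total_time.
  have := way_cost_le (erefl m).
  have := way_cost_le (size_map _ _ : size swap_arcs = m).
  have lN : l <= N by rewrite leq_pmull.
  have ARC_NEXT : N <= N * (trunc_log 2 N).+1 by rewrite leq_pmulr.
  have mY : m <= l * m by rewrite leq_pmull.
  rewrite /total_time; move: (way_cost _ _) (way_cost _ _) => w w' le le'.
  apply: leq_trans (_ : unit_cost * (l.+2 + N.+2 + (62 * N + 2 * m +
    30 * (N * (trunc_log 2 N).+1) + 28 * (l * m))) <= _); last first.
    by rewrite leq_mul2l; apply/orP; right; move: (_ * _.+1) (l * m) ARC_NEXT mY => X Y; lia.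
  rewrite !mulnDr in le le' *; move: (unit_cost * _) (unit_cost * _) => a b; lia.
apply: wp_seq.
apply: wp_mono (wp_frame (prepare_spec (n := n) n0 _ _ _ _ leT)) _ => //.
  by rewrite /= size_tuple.
move=> T1 s1 [[ly1 le1] fr1].
have in1 a : a \in [:: 0; 1; 2; 3] -> ints s1 a = ints s0 a.
  by rewrite !inE => /or4P[]/eqP->; apply: (frame_ints fr1).
have wk1 : reals s1 = reals s0 by apply/funext => x; apply: (frame_reals fr1).
have hs1 := frame_heap fr1 isT.
have ok1 : way_ok l true A arcs i0 s1 (fun=> 0) (fun=> [::]).
  split=> //.
  - by rewrite hs1 wk1.
  - by move=> d; rewrite hs1.
  - exact: (input_fwd in1 (congr1 (fun f => f 0) wk1)).
  - by move=> u _; rewrite (frame_ints (a := REACHED) fr1).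
rewrite -hs1 in pot0.
apply: wp_seq.
have {}le1 : potential N (heap_of s1) (fun=> [::]) + way_cost l arcs +
    way_cost l swap_arcs <= T1 by rewrite pot0.
have H := one_way_spec (fwd := true) l0 le0_arcs ok1 le1.
apply: wp_mono (wp_frame H) _ => T2 s2 [[f2 [K2 [[ok2 t2 ly2 io2 f02] le2 res2]]] fr2].
have {}in1 a : a \in [:: 0; 1; 2; 3] -> ints s2 a = ints s0 a.
  move=> a4; rewrite -in1 //; move: a4.
  by rewrite !inE => /or4P[]/eqP->; apply: (frame_ints fr2).
have wk2 : reals s2 0 = reals s0 0 by rewrite (frame_reals fr2) // wk1.
have ok2' : way_ok l false A^T swap_arcs i0 s2 f2 K2.
  by split=> //; apply: input_bwd.
have {}le2 : potential N (heap_of s2) K2 + way_cost l swap_arcs + 0 <= T2.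
  by rewrite addn0.
have {}H := one_way_spec (fwd := false) l0 le0_swap ok2' le2.
apply: wp_mono (wp_frame H) _ => T3 s3 [[f3 [K3 [_ _ res3]]] fr3].
split=> k j.
- apply: output_is_max (reach_rows k j) _.
  by rewrite (frame_ints (a := 4) fr3) // (frame_reals (a := 1) fr3) //; exact: res2.
- by apply: output_is_max (reach_cols k j) _; exact: res3.
Qed.

Lemma total_time_le :
  (total_time%:R <= (1000 * unit_cost)%:R * (l%:R * (m%:R + n%:R * ln n%:R)) :> R)%R.
Proof.
rewrite /total_time [(1000 * unit_cost)%N]mulnC [in leLHS]natrM [in leRHS]natrM -mulrA.
apply: ler_wpM2l; first exact: ler0n.
rewrite natrD !natrM.
have ln0 : (0 <= ln n%:R :> R)%R by rewrite ln_ge0 // ler1n.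
have lm : (1 <= l%:R * m%:R :> R)%R.
  by rewrite -natrM ler1n muln_gt0 l0 arcs_pos.
have [n1|n1] := leqP n 1.
  have en : n = 1 by lia.
  have el : l = 1 by have := length_le; lia.
  have eL : trunc_log 2 N = 0 by rewrite /N en el.
  rewrite eL /N el en ln1 in lm *; lra.
have lb : ((trunc_log 2 N).+1%:R <= 6 * ln n%:R :> R)%R.
  by apply: log_bound; rewrite ?muln_gt0 ?n0 //= leq_mul2l length_le orbT.
rewrite /N ?natrM.
have : (n%:R * l%:R * (trunc_log 2 N).+1%:R <= n%:R * l%:R * (6 * ln n%:R) :> R)%R.
  by apply: ler_wpM2l lb; rewrite -natrM ler0n.
rewrite mulrDr.
have : (0 <= l%:R * (n%:R * ln n%:R) :> R)%R by rewrite !mulr_ge0.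
rewrite -/N => h1 h2; move: lm h1 h2.
have -> : (n%:R * l%:R * (6 * ln n%:R) = 6 * (l%:R * (n%:R * ln n%:R)) :> R)%R by ring.
lra.
Qed.

End Final.

Local Open Scope ring_scope.

Theorem mainTheorem4 :
  exists (prog : cmd) (K : nat), forall (R : realType)
    (n m l : nat) (A : 'M[Rmax R]_n) (arcs : seq ('I_n * 'I_n))
    (c : l.-tuple 'I_n),
    visualized A -> lambda A = Fin 0 -> num_finite A = m -> lists_arcs A arcs ->
    critical A c -> elementary_circuit A c ->
  exists (t : nat) (s : memory R),
    [/\ exec prog (input A arcs c) t s,
        t%:R <= K%:R * (l%:R * (m%:R + n%:R * ln n%:R)) :> R,
        forall (k : 'I_l) (j : 'I_n),
          row_output s k j = kleene_star (A ^+ l) (tnth c k) j /\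
          col_output s k j = kleene_star (A ^+ l) j (tnth c k)
      & forall (k : 'I_l) (j : 'I_n),
          is_max (path_weights_mod A l (tnth c k) j) (row_output s k j) /\
          is_max (path_weights_mod A l j (tnth c k)) (col_output s k j)].
Proof.
exists row_col_program, (1000 * unit_cost)%N => R n m l A arcs c visA lamA <- arcsA critA elemA.
have [t [s [ex le_t rows cols]]] := main_spec visA lamA arcsA critA elemA.
have l0 := length_pos critA.
exists t, s; split=> //.
- rewrite -(size_arcs arcsA).
  apply: le_trans (total_time_le visA lamA arcsA critA elemA).
  by rewrite ler_nat.
- by move=> k j; rewrite (kleene_starE l0 (rows k j)) (kleene_starE l0 (cols k j)).
Qed.
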